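(* Let $n\ge 2$ and let $\mathbb B^n=\{z\in\mathbb C^n: |z_1|^2+\dots+|z_n|^2<1\}$ be the open unit ball. Then the canonical solution operator to $\overline\partial$ restricted to $(0,1)$-forms with coefficients in the Bergman space, $$S_1:A^2_{(0,1)}(\mathbb B^n)\to L^2(\mathbb B^n),$$ is not a Hilbert-Schmidt operator.
   Context: For a bounded domain $\Omega\subset\mathbb C^n$, $\lambda$ is Lebesgue measure, $L^2(\Omega)=L^2(\Omega,\lambda)$, and $A^2(\Omega)$ is the Bergman space of square-integrable holomorphic functions on $\Omega$. $A^2_{(0,1)}(\Omega)$ is the space of $(0,1)$-forms $g=\sum_{j=1}^n g_j\,d\overline z_j$ with all $g_j\in A^2(\Omega)$, a Hilbert space with norm $\|g\|^2=\sum_{j=1}^n\|g_j\|^2_{L^2(\Omega)}$. The canonical solution operator assigns to $g$ the unique $S_1(g)\in L^2(\Omega)$ with $\overline\partial S_1(g)=g$ and $S_1(g)\perp A^2(\Omega)$; equivalently, $S_1(g)=v-P(v)$ with $v(z)=\sum_{j=1}^n\overline z_j g_j(z)$ and $P:L^2(\Omega)\to A^2(\Omega)$ the orthogonal projection. *)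

(* Defs.v *)
(* MathComp-Analysis development over an arbitrary R : realType, with C = R[i]
   and C^n = 'rV[R[i]]_n.  A class in L^2(Omega) is represented by a function
   on all of C^n: its values outside Omega are ignored, and integrability,
   inner products and distributional derivatives do not see null sets. *)
From HB Require Import structures.
From mathcomp Require Import all_boot all_order all_algebra complex.
From mathcomp Require Import all_classical all_reals all_analysis.

Set Implicit Arguments.
Unset Strict Implicit.
Unset Printing Implicit Defensive.
Import Order.TTheory GRing.Theory Num.Theory.
Import numFieldNormedType.Exports.

Local Open Scope classical_set_scope.
Local Open Scope ring_scope.
Local Open Scope complex_scope.

(* The usual topology on C = R[i], and C as a normed space over itself; the
   library only provides these structures on the alias R[i]^o. *)
HB.instance Definition _ (R : realType) :=
  PseudoPointedMetric.copy R[i] (R[i]^o).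
HB.instance Definition _ (R : realType) := NormedModule.copy R[i] (R[i]^o).

(* m1 \x m2 with its sigma-finite structure, which the library does not infer
   outside of subprobabilities. *)
Section sigma_finite_product.
Local Open Scope ereal_scope.
Context d1 d2 (T1 : measurableType d1) (T2 : measurableType d2) (R : realType).
Variables (m1 : {sigma_finite_measure set T1 -> \bar R})
  (m2 : {sigma_finite_measure set T2 -> \bar R}).

Definition sigma_finite_product : set (T1 * T2) -> \bar R := m1 \x m2.

HB.instance Definition _ := Measure.on sigma_finite_product.

Let sigma_finite_product_sigma_finite : sigma_finite setT sigma_finite_product.
Proof.
have /sigma_finiteP[F [TF ndF Foo]] := sigma_finiteT m1.
have /sigma_finiteP[G [TG ndG Goo]] := sigma_finiteT m2.
exists (fun k => F k `*` G k).
  rewrite -setXTT TF TG; apply/seteqP; split=> [[x y] /=|[x y] [k _ []]].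
    move=> [[i _ Fix] [j _ Gjy]]; exists (maxn i j) => //; split.
    - by move: x Fix; exact/subsetPset/ndF/leq_maxl.
    - by move: y Gjy; exact/subsetPset/ndG/leq_maxr.
  by split; exists k.
move=> k; have [mF Fk] := Foo k; have [mG Gk] := Goo k.
split; first exact: measurableX.
rewrite [sigma_finite_product _]product_measure1E//.
by rewrite lte_mul_pinfty// ge0_fin_numE.
Qed.

HB.instance Definition _ := @Measure_isSigmaFinite.Build _ _ _
  sigma_finite_product sigma_finite_product_sigma_finite.

End sigma_finite_product.

Section tuple_cons.
Context (T : Type).

Definition tuple_cons n (p : T * n.-tuple T) : n.+1.-tuple T :=
  [tuple of p.1 :: p.2].

Definition tuple_uncons n (t : n.+1.-tuple T) : T * n.-tuple T :=
  (thead t, [tuple of behead t]).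

Lemma tuple_consK n : cancel (@tuple_cons n) (@tuple_uncons n).
Proof. by move=> [x t]; congr pair; apply/val_inj. Qed.

Lemma tuple_unconsK n : cancel (@tuple_uncons n) (@tuple_cons n).
Proof. by move=> t; rewrite [RHS]tuple_eta. Qed.

End tuple_cons.

(* The n-fold product of a sigma-finite measure, on n.-tuple T. *)
Section tuple_measure.
Local Open Scope ereal_scope.
Context d (T : measurableType d) (R : realType).

Lemma measurable_tuple_cons n : measurable_fun setT (@tuple_cons T n).
Proof. exact: measurable_cons. Qed.

Lemma measurable_tuple_uncons n : measurable_fun setT (@tuple_uncons T n).
Proof.
apply/measurable_fun_pairP; split; first exact: measurable_tnth.
exact: measurable_behead.
Qed.

Definition tuple_measure0 : set (0.-tuple T) -> \bar R := \d_([tuple]).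

HB.instance Definition _ := Measure.on tuple_measure0.

Let tuple_measure0_sigma_finite : sigma_finite setT tuple_measure0.
Proof.
apply: fin_num_fun_sigma_finite; first by rewrite measure0.
by move=> A mA; rewrite /tuple_measure0/= diracE.
Qed.

HB.instance Definition _ := @Measure_isSigmaFinite.Build _ _ _
  tuple_measure0 tuple_measure0_sigma_finite.

Definition tuple_measureS n (m : {sigma_finite_measure set T -> \bar R})
    (mu : {sigma_finite_measure set (n.-tuple T) -> \bar R}) :
    set (n.+1.-tuple T) -> \bar R :=
  pushforward (sigma_finite_product m mu) (@tuple_cons T n).

Section step.
Context (n : nat) (m : {sigma_finite_measure set T -> \bar R})
  (mu : {sigma_finite_measure set (n.-tuple T) -> \bar R}).

HB.instance Definition _ := Measure.copy (tuple_measureS m mu)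
  (measure_function_pushforward__canonical__measure_function_Measure
     (sigma_finite_product m mu) (@measurable_tuple_cons n)).

Let tuple_measureS_sigma_finite : sigma_finite setT (tuple_measureS m mu).
Proof.
have [F TF Foo] := sigma_finiteT (sigma_finite_product m mu).
exists (fun k => @tuple_uncons T n @^-1` F k).
  by rewrite -preimage_bigcup -TF preimage_setT.
move=> k; have [mF Fk] := Foo k; split.
  by rewrite -[X in measurable X]setTI; exact: measurable_tuple_uncons.
rewrite /tuple_measureS /pushforward -comp_preimage.
rewrite (_ : _ \o _ = id) ?preimage_id//.
by apply/funext => p /=; rewrite tuple_consK.
Qed.

HB.instance Definition _ := @Measure_isSigmaFinite.Build _ _ _
  (tuple_measureS m mu) tuple_measureS_sigma_finite.
End step.

Fixpoint tuple_measure (m : {sigma_finite_measure set T -> \bar R}) n :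
    {sigma_finite_measure set (n.-tuple T) -> \bar R} :=
  if n is k.+1 then tuple_measureS m (tuple_measure m k) else tuple_measure0.

End tuple_measure.

Definition lebesgue_plane (R : realType) :
    {sigma_finite_measure set (measurableTypeR R * measurableTypeR R)%type
      -> \bar R} :=
  sigma_finite_product (@lebesgue_measure R) (@lebesgue_measure R).

Definition Cn_display : measure_display.
Proof. exact: default_measure_display. Qed.

Section Cn_measurable.
Context (R : realType) (n : nat).

Definition Cn_coord (i : 'I_n) (z : 'rV[R[i]]_n) :
    measurableTypeR R * measurableTypeR R :=
  (complex.Re (z ord0 i), complex.Im (z ord0 i)).

(* The sigma-algebra on C^n generated by the real coordinates (the Borel
   sigma-algebra). *)
HB.instance Definition _ := @isMeasurable.Build Cn_display 'rV[R[i]]_n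
  (g_sigma_preimage Cn_coord) (@sigma_algebra0 _ _ _)
  (@sigma_algebraC _ _) (@sigma_algebra_bigcup _ _ _).

Definition Cn_of_tuple (t : n.-tuple (measurableTypeR R * measurableTypeR R)) :
    'rV[R[i]]_n :=
  \row_i ((tnth t i).1 +i* (tnth t i).2).

Lemma measurable_Cn_of_tuple : measurable_fun setT Cn_of_tuple.
Proof.
have coordE i : Cn_coord i \o Cn_of_tuple = @tnth _ _ ^~ i.
  by apply/funext => t /=; rewrite /Cn_coord !mxE /=; case: (tnth t i).
have : g_sigma_preimage (fun i => Cn_coord i \o Cn_of_tuple) `<=` measurable.
  by under [X in g_sigma_preimage X]eq_fun do rewrite coordE.
by rewrite g_sigma_preimage_comp => sub _ A mA; apply: sub; exists A.
Qed.

(* Lebesgue measure on C^n, identified with (R * R)^n. *)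
Definition lebesgue_Cn : set 'rV[R[i]]_n -> \bar R :=
  pushforward (tuple_measure (lebesgue_plane R) n) Cn_of_tuple.

HB.instance Definition _ := Measure.copy lebesgue_Cn
  (measure_function_pushforward__canonical__measure_function_Measure
     (tuple_measure (lebesgue_plane R) n) measurable_Cn_of_tuple).

End Cn_measurable.

Section bergman.
Context (R : realType) (n : nat).
Local Notation C := R[i].
Local Notation Cn := 'rV[C]_n.
Implicit Types (Omega : set Cn) (f g u phi : Cn -> C).

Definition unit_ball : set Cn := [set z : Cn | \sum_j `|z ord0 j| ^+ 2 < 1].

Definition Cintegral Omega f : C :=
  (\int[@lebesgue_Cn R n]_(z in Omega) complex.Re (f z)) +i*
  (\int[@lebesgue_Cn R n]_(z in Omega) complex.Im (f z)).

Definition L2 Omega : set (Cn -> C) := [set f : Cn -> C |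
  [/\ measurable_fun Omega (fun z => complex.Re (f z)),
      measurable_fun Omega (fun z => complex.Im (f z)) &
      (\int[@lebesgue_Cn R n]_(z in Omega)
         (complex.Re (`|f z| ^+ 2 : C))%:E < +oo)%E]].

Definition L2_inner Omega f g : C := Cintegral Omega (fun z => f z * (g z)^*).

(* Complex (Frechet) differentiability, over the scalar field C. *)
Definition holomorphic Omega f := forall z, Omega z -> differentiable f z.

Definition bergman_space Omega : set (Cn -> C) :=
  [set f : Cn -> C | holomorphic Omega f /\ L2 Omega f].

(* A (0,1)-form \sum_j g_j d\bar z_j is the family g of its coefficients. *)
Definition bergman_forms Omega : set ('I_n -> Cn -> C) :=
  [set g | forall j, bergman_space Omega (g j)].

Definition form_inner Omega (g h : 'I_n -> Cn -> C) : C :=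
  \sum_j L2_inner Omega (g j) (h j).

(* Derivative of phi at z along v with respect to a real parameter. *)
Definition real_deriv (v : Cn) phi (z : Cn) : C :=
  (derive1 (fun t : R => complex.Re (phi (z + t%:C *: v))) 0) +i*
  (derive1 (fun t : R => complex.Im (phi (z + t%:C *: v))) 0).

Definition real_derivable (v : Cn) phi (z : Cn) : Prop :=
  derivable (fun t : R => complex.Re (phi (z + t%:C *: v))) 0 1 /\
  derivable (fun t : R => complex.Im (phi (z + t%:C *: v))) 0 1.

(* C^k as a function of the 2n real variables. *)
Fixpoint real_Ck (k : nat) phi : Prop :=
  continuous phi /\
  if k is k'.+1 then
    forall v, (forall z, real_derivable v phi z) /\
              real_Ck k' (real_deriv v phi)
  else True.

Definition test_function Omega phi : Prop :=
  (forall k, real_Ck k phi) /\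
  exists2 K : set Cn, compact K /\ K `<=` Omega &
    forall z, ~ K z -> phi z = 0.

(* d phi / d \bar z_j = (d phi / d x_j + i d phi / d y_j) / 2 *)
Definition dbar_deriv (j : 'I_n) phi (z : Cn) : C :=
  2^-1 * (real_deriv (delta_mx ord0 j) phi z +
          'i%C * real_deriv ('i%C *: delta_mx ord0 j) phi z).

(* \bar\partial u = g on Omega, in the sense of distributions. *)
Definition dbar_eq Omega u (g : 'I_n -> Cn -> C) : Prop :=
  forall phi, test_function Omega phi -> forall j,
    Cintegral Omega (fun z => u z * dbar_deriv j phi z) =
    - Cintegral Omega (fun z => g j z * phi z).

(* S maps each g with coefficients in A^2 to the L^2 solution of
   \bar\partial u = g that is orthogonal to A^2. *)
Definition canonical_solution_operator Omega
    (S : ('I_n -> Cn -> C) -> Cn -> C) : Prop :=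
  forall g : 'I_n -> Cn -> C, bergman_forms Omega g ->
    [/\ L2 Omega (S g), dbar_eq Omega (S g) g &
        forall h, bergman_space Omega h -> L2_inner Omega (S g) h = 0].

End bergman.

Section hilbert_schmidt.
Context (R : realType) (V : lmodType R[i]) (W : Type).
Variables (H : set V) (ipV : V -> V -> R[i]) (ipW : W -> W -> R[i]).

(* Orthonormal family in H with dense linear span. *)
Definition orthonormal_basis (I : choiceType) (e : I -> V) : Prop :=
  [/\ forall i, H (e i),
      forall i j, ipV (e i) (e j) = (i == j)%:R &
      forall v, H v -> forall eps : R, 0 < eps ->
        exists (s : seq I) (c : I -> R[i]),
          let w := v - \sum_(i <- s) c i *: e i in
          complex.Re (ipV w w) < eps].

(* \sum_i ||T e_i||^2 < oo for some orthonormal basis (e_i) of H; the norm on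
   the target is the one of ipW. *)
Definition hilbert_schmidt (T : V -> W) : Prop :=
  exists (I : choiceType) (e : I -> V), orthonormal_basis e /\
    (\esum_(i in [set: I]) (complex.Re (ipW (T (e i)) (T (e i))))%:E < +oo)%E.

End hilbert_schmidt.

(* Main.v *)
(** Only the weak equation [dbar (S g) = g] is used.  Against a test function
    phi it gives [<S g, conj (dbar_j phi)> = - <g_j, conj phi>], so for an
    orthonormal basis (e_m), Bessel's inequality in L^2 for pairwise orthogonal
    psi_k = conj (dbar_j phi_k) followed by Parseval's identity in the space of
    forms bounds [sum_m |S e_m|^2] below by
    [sum_k |<h_k, conj phi_k>|^2 / (|h_k|^2 |psi_k|^2)] for any h_k in A^2.
    Take i <> j (this is where n >= 2 enters), h_k = z_i^k and
    phi_k = conj(z_i)^k chi_k(|z|^2), with chi_k a smooth cutoff at distance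
    about 1/k from the sphere.  The psi_k are orthogonal because
    z |-> c z with |c| = 1 multiplies psi_k by c^k conj(c).  Let
    A_k = |z_i^k|^2.  Homogeneity gives <h_k, conj phi_k> >= const A_k, and
    |z_j|^2 <= 1 - |z_i|^2 gives |psi_k|^2 <= const k^2 (A_k - A_(k+1)).
    The k-th term is thus at least const / (k^2 x_k) with
    x_k = ln (A_k / A_(k+1)), up to a harmless correction.  Since A_k decays at
    most polynomially, the sum of the x_k up to N is O(ln N), which forces
    [sum_k 1 / (k^2 x_k)] to diverge. *)

Require Import Defs.
From mathcomp Require Import all_boot all_order all_algebra complex.
From mathcomp Require Import all_classical all_reals all_analysis.
From mathcomp Require Import measurable_realfun ring lra.

Set Implicit Arguments.
Unset Strict Implicit.
Unset Printing Implicit Defensive.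
Import Order.TTheory GRing.Theory Num.Theory.
Import numFieldNormedType.Exports.

Local Open Scope classical_set_scope.
Local Open Scope ring_scope.
Local Open Scope complex_scope.

(** * Lebesgue measure under complex scaling *)

(** The gain from [j != i] is that [dbar_j] of a radial cutoff carries the factor z_j, which is
    small where z_i^k has its mass. The cutoff must stay within about 1/k of the sphere to keep a
    fixed share of |z_i^k|^2, so its derivative costs k^2 in |psi_k|^2; without the gain the k-th
    term would be of order 1/k^2, and that series converges. The size of the gain, 1 - A_(k+1)/A_k,
    is never computed. Bounding it by a logarithm makes it telescope, and a crude lower bound on
    A_k, read off from a small box inside the ball, replaces the Beta integral for the moments. No
    polar coordinates occur either: the substitution z |-> c z supplies homogeneity for c = sqrt r
    and orthogonality for |c| = 1. The orthonormal basis is arbitrary, with any choice type as index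
    set, so the estimates run over finite sums: for each N one finite set of indices catches, up to
    a factor 4, the Parseval mass of all pairings with k < N. *)

Section affine.
Context {R : realType}.
Local Notation mu := (@lebesgue_measure R).
Variables (a b : R).
Hypothesis a0 : a != 0.

Let aff : measurableTypeR R -> measurableTypeR R := fun x => a * x + b.

Let maff : measurable_fun setT aff.
Proof. by apply: measurable_funD => //; exact: mulrl_measurable. Qed.

Let aff_measure : {measure set (measurableTypeR R) -> \bar R} :=
  mscale (NngNum (normr_ge0 a))
    (measure_function_pushforward__canonical__measure_function_Measure mu maff).

(** Lebesgue measure is determined by its values on half-open intervals, and there |a| times the
    length of the preimage is the length of the interval. *)
Let aff_measureE A : measurable A -> mu A = aff_measure A.
Proof.
apply: lebesgue_measure_unique => _ [[x y]] _ <-/=.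
rewrite /aff_measure /mscale/= /pushforward.
have [a_gt0|a_le0] := ltP 0 a.
  have -> : aff @^-1` `]x, y] = `](x - b) / a, (y - b) / a]%classic.
    apply/seteqP; split => z /=; rewrite !in_itv/= /aff;
    by rewrite ltr_pdivrMr// ler_pdivlMr// ltrBlDr lerBrDr mulrC.
  rewrite !lebesgue_measure_itv/= !lte_fin ltr_pM2r ?invr_gt0// ltrD2r.
  case: ifPn => xy; last by rewrite mule0.
  rewrite -!EFinB -EFinM gtr0_norm//; congr (_%:E).
  by field.
have {a_le0} a_lt0 : a < 0 by rewrite lt_neqAle a0.
(* For a < 0 the map reverses the order, so the preimage is closed on the left and open on the
   right; its length is the same. *)
have -> : aff @^-1` `]x, y] = `[(y - b) / a, (x - b) / a[%classic.
  apply/seteqP; split => z /=; rewrite !in_itv/= /aff;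
  by rewrite ltr_ndivlMr// ler_ndivrMr// ltrBlDr lerBrDr mulrC andbC.
rewrite !lebesgue_measure_itv/= !lte_fin ltr_nM2r ?invr_lt0// ltrD2r.
case: ifPn => xy; last by rewrite mule0.
rewrite -!EFinB -EFinM ltr0_norm//; congr (_%:E).
by field.
Qed.

Lemma ge0_integral_affine (f : R -> \bar R) :
  measurable_fun [set: measurableTypeR R] f -> (forall x, 0 <= f x)%E ->
  (\int[mu]_x f x = `|a|%:E * \int[mu]_x f (a * x + b)%R)%E.
Proof.
move=> mf f0.
rewrite (eq_measure_integral aff_measure); last by move=> A mA _; exact: aff_measureE.
rewrite ge0_integral_mscale//=; congr *%E.
by rewrite ge0_integral_pushforward.
Qed.

End affine.

Section plane.
Context {R : realType}.
Local Notation T := (measurableTypeR R).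

Definition sqnormc (c : R[i]) : R := complex.Re c ^+ 2 + complex.Im c ^+ 2.

Definition plane_mul (c : R[i]) (p : T * T) : T * T :=
  (complex.Re c * p.1 - complex.Im c * p.2, complex.Im c * p.1 + complex.Re c * p.2).

Lemma measurable_plane_mul c : measurable_fun setT (plane_mul c).
Proof.
apply/measurable_fun_pairP; split.
  by apply: measurable_funB; exact: measurable_funM.
by apply: measurable_funD; exact: measurable_funM.
Qed.

Lemma plane_mulM c d p : plane_mul (c * d) p = plane_mul c (plane_mul d p).
Proof.
case: c d => [a b] [x y]; rewrite /plane_mul/=; congr pair; ring.
Qed.

Local Open Scope ereal_scope.

Let plane_mul_Re c (f : T * T -> \bar R) : complex.Re c != 0%R ->
  measurable_fun setT f -> (forall p, 0 <= f p) ->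
  \int[lebesgue_plane R]_p f p =
  (sqnormc c)%:E * \int[lebesgue_plane R]_p f (plane_mul c p).
Proof.
case: c => a b /= a0 mf f0; rewrite /sqnormc/=.
have mfg (g : T * T -> T * T) : measurable_fun setT g -> measurable_fun setT (f \o g).
  by move=> mg; exact: measurableT_comp.
(* Multiplication by a + ib is (x, y) |-> (a x - b y, y) followed by the map [g] below. Each of the
   two alters one coordinate by an affine map, and the factors multiply to |a| |D| = |c|^2. *)
pose s := (b / a)%R; pose D := ((a ^+ 2 + b ^+ 2) / a)%R.
have D0 : D != 0%R.
  rewrite mulf_neq0 ?invr_eq0// gt_eqF//.
  by rewrite ltr_pwDl ?sqr_ge0// exprn_even_gt0.
have fg0 g : forall p : T * T, 0 <= (f \o g) p by move=> p; exact: f0.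
pose c := a +i* b.
have mfc : measurable_fun setT (f \o plane_mul c).
  by apply: mfg; exact: measurable_plane_mul.
pose g (p : T * T) : T * T := (p.1, s * p.1 + D * p.2)%R.
have mfh : measurable_fun setT (f \o g).
  apply: mfg; apply/measurable_fun_pairP; split; first exact: measurable_fst.
  by apply: measurable_funD; exact: measurable_funM.
rewrite /lebesgue_plane [LHS](fubini_tonelli1 f)//.
rewrite [X in _ = _ * X](fubini_tonelli2 (f \o plane_mul c))//.
rewrite /fubini_F /fubini_G.
transitivity (`|D|%:E * \int[@lebesgue_measure R]_x
    \int[@lebesgue_measure R]_y (f \o g) (x, y)).
  rewrite -ge0_integralZl//; first last.
  - by move=> x _; apply: integral_ge0 => y _; exact: fg0.
  - exact: (measurable_fun_fubini_tonelli_F (f \o g)).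
  apply: eq_integral => x _.
  rewrite (@ge0_integral_affine R D (s * x)%R D0 (fun y => f (x, y)))//; last first.
    exact: (measurableT_comp mf (measurable_pair1 x)).
  by congr (_ * _); apply: eq_integral => y _; rewrite /g/= addrC.
rewrite [X in _ * X = _](fubini_tonelli (f \o g) mfh (fg0 g)).
transitivity (`|D|%:E * \int[@lebesgue_measure R]_y (`|a|%:E *
    \int[@lebesgue_measure R]_x (f \o plane_mul c) (x, y))).
  congr (_ * _); apply: eq_integral => y _ /=.
  rewrite (@ge0_integral_affine R a (- b * y)%R a0 (fun x => f (g (x, y))))//; last first.
    exact: (measurableT_comp mfh (measurable_pair2 y)).
  congr (_ * _); apply: eq_integral => x _; congr f; rewrite /plane_mul/= /g/= /s /D.
  by congr pair; [ring|field].
rewrite ge0_integralZl//; first last.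
- by move=> x _; apply: integral_ge0 => y _; exact: fg0.
- exact: (measurable_fun_fubini_tonelli_G (f \o plane_mul c)).
rewrite muleA -EFinM -normrM /D divfK// ger0_norm//.
by rewrite addr_ge0 ?sqr_ge0.
Qed.

Lemma ge0_integral_plane_mul c (f : T * T -> \bar R) : c != 0%R ->
  measurable_fun setT f -> (forall p, 0 <= f p) ->
  \int[lebesgue_plane R]_p f p =
  (sqnormc c)%:E * \int[lebesgue_plane R]_p f (plane_mul c p).
Proof.
move=> c0 mf f0.
have [c1|] := eqVneq (complex.Re c) 0%R; last by move=> /plane_mul_Re; exact.
case: c c0 c1 => a b c0 /= a0; rewrite {}a0 in c0 *.
have b0 : b != 0%R by apply: contra_neq c0 => ->.
(* a purely imaginary c is a product of two numbers with nonzero real parts,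
   for which two one-dimensional affine substitutions suffice *)
pose d : R[i] := ((b / 2) +i* (b / 2))%R; pose e : R[i] := (1 +i* 1)%R.
have -> : (0 +i* b = e * d :> R[i])%R by rewrite /d /e; simpc; congr (_ +i* _)%R; field.
rewrite (@plane_mul_Re e f) ?oner_eq0//.
rewrite (@plane_mul_Re d (f \o plane_mul e))//=; last 2 first.
- by rewrite mulf_neq0// invr_eq0 pnatr_eq0.
- by apply: measurableT_comp => //; exact: measurable_plane_mul.
rewrite muleA -EFinM; congr (_%:E * _); first by rewrite /sqnormc/=; field.
by apply: eq_integral => p _; rewrite plane_mulM.
Qed.

End plane.

(** * Lebesgue measure on C^n: Tonelli over the coordinates *)

Section tuple_integral.
Context d (T : measurableType d) (R : realType).
Variable m : {sigma_finite_measure set T -> \bar R}.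
Local Open Scope ereal_scope.

Lemma ge0_integral_tuple_cons n (f : n.+1.-tuple T -> \bar R) :
  measurable_fun setT f -> (forall t, 0 <= f t) ->
  \int[tuple_measure m n.+1]_t f t =
  \int[m]_p \int[tuple_measure m n]_t f (tuple_cons (p, t)).
Proof.
move=> mf f0.
transitivity (\int[pushforward (sigma_finite_product m (tuple_measure m n))
    (@tuple_cons T n)]_t f t); first by [].
have mc := @measurable_tuple_cons _ T n.
rewrite (ge0_integral_pushforward mc (sigma_finite_product m (tuple_measure m n)))//.
rewrite preimage_setT.
have mfc := measurableT_comp mf mc.
exact: (fubini_tonelli1 (f \o @tuple_cons T n) mfc (fun p => f0 (tuple_cons p))).
Qed.

End tuple_integral.

Section Cn_integral.
Context {R : realType}.
Local Notation T := (measurableTypeR R * measurableTypeR R)%type.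

Definition tuple_mul n (c : R[i]) (t : n.-tuple T) : n.-tuple T :=
  map_tuple (plane_mul c) t.

Lemma measurable_tuple_mul n c : measurable_fun setT (@tuple_mul n c).
Proof.
apply/measurable_fun_tnthP => i.
rewrite (_ : _ \o _ = plane_mul c \o (fun t => tnth t i)); last first.
  by apply/funext => t /=; rewrite tnth_map.
by apply: measurableT_comp; [exact: measurable_plane_mul|exact: measurable_tnth].
Qed.

Local Open Scope ereal_scope.

(** Tonelli splits off one coordinate at a time, and each contributes one factor |c|^2. *)
Lemma ge0_integral_tuple_mul n c (f : n.-tuple T -> \bar R) : c != 0%R ->
  measurable_fun setT f -> (forall t, 0 <= f t) ->
  \int[tuple_measure (lebesgue_plane R) n]_t f t =
  (sqnormc c ^+ n)%:E *
    \int[tuple_measure (lebesgue_plane R) n]_t f (tuple_mul c t).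
Proof.
move=> c0; have N0 : (0 <= sqnormc c)%R by rewrite addr_ge0 ?sqr_ge0.
elim: n => [|n IH] in f * => mf f0.
  rewrite expr0 mul1e; apply: eq_integral => t _; congr f.
  by rewrite [t]tuple0 [RHS]tuple0.
have mcons := @measurable_tuple_cons _ T n.
have mfc : measurable_fun setT (f \o @tuple_cons T n) := measurableT_comp mf mcons.
have f0c p : 0 <= (f \o @tuple_cons T n) p by exact: f0.
have mfm := measurableT_comp mf (@measurable_tuple_mul n.+1 c).
rewrite (@ge0_integral_tuple_cons _ _ _ _ _ f mf f0).
rewrite (@ge0_integral_tuple_cons _ _ _ _ _ (f \o tuple_mul c) mfm (fun t => f0 _)).
have mF := measurable_fun_fubini_tonelli_F
  (m2 := tuple_measure (lebesgue_plane R) n) _ mfc f0c.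
have F0 p : 0 <= fubini_F (tuple_measure (lebesgue_plane R) n) (f \o @tuple_cons T n) p.
  by apply: integral_ge0 => t _; exact: f0.
rewrite [LHS](ge0_integral_plane_mul c0 mF F0).
rewrite exprSr EFinM -muleA muleCA; congr (_ * _).
pose F p := \int[tuple_measure (lebesgue_plane R) n]_t f (tuple_mul c (tuple_cons (p, t))).
rewrite -(@ge0_integralZl _ _ _ _ setT _ F)//; last 3 first.
- exact: (measurable_fun_fubini_tonelli_F
    (m2 := tuple_measure (lebesgue_plane R) n) (f \o (tuple_mul c \o @tuple_cons T n))
     (measurableT_comp mfm mcons) (fun p => f0 _)).
- by move=> p _; apply: integral_ge0 => t _; exact: f0.
- by rewrite lee_fin exprn_ge0.
apply: eq_integral => p _; rewrite /fubini_F.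
rewrite (IH (fun t => f (tuple_cons (plane_mul c p, t))))//; last first.
  exact: (measurableT_comp mfc (measurable_pair1 (plane_mul c p))).
congr (_ * _); apply: eq_integral => t _; congr f.
by apply/val_inj.
Qed.

Lemma measurable_Cn_coord n (i : 'I_n) : measurable_fun setT (@Cn_coord R n i).
Proof.
move=> _ Y mY; rewrite setTI; apply: sub_sigma_algebra => /=.
rewrite -bigcup_seq/=; exists i => /=; first by rewrite mem_index_enum.
by exists Y => //; rewrite setTI.
Qed.

Lemma measurable_fun_CnP d (X : measurableType d) n (f : X -> 'rV[R[i]]_n) :
  (forall i, measurable_fun setT (Cn_coord i \o f)) -> measurable_fun setT f.
Proof.
move=> mf; have sub : g_sigma_preimage (fun i => Cn_coord i \o f) `<=` measurable.
  apply: smallest_sub; first exact: sigma_algebra_measurable.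
  move=> A; rewrite -bigcup_seq/= => -[i _ [B mB <-]]; exact: mf.
by move: sub; rewrite g_sigma_preimage_comp => sub _ A mA; apply: sub; exists A.
Qed.

Lemma measurable_Cn_scale n (c : R[i]) :
  measurable_fun setT (fun z : 'rV[R[i]]_n => c *: z).
Proof.
apply: measurable_fun_CnP => i.
rewrite (_ : _ \o _ = plane_mul c \o Cn_coord i); last first.
  apply/funext => z /=; rewrite /Cn_coord /plane_mul !mxE.
  by case: c (z ord0 i) => a b [x y] /=; congr pair; ring.
by apply: measurableT_comp; [exact: measurable_plane_mul|exact: measurable_Cn_coord].
Qed.

Lemma ge0_integral_Cn n (f : 'rV[R[i]]_n -> \bar R) :
  measurable_fun setT f -> (forall z, 0 <= f z) ->
  \int[@lebesgue_Cn R n]_z f z =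
  \int[tuple_measure (lebesgue_plane R) n]_t f (Cn_of_tuple t).
Proof.
move=> mf f0; rewrite /lebesgue_Cn.
rewrite (ge0_integral_pushforward (@measurable_Cn_of_tuple R n)
  (tuple_measure (lebesgue_plane R) n))//.
Qed.

(** The real Jacobian of z |-> c z on C^n is |c|^(2n). Taken with c = sqrt r this gives the
    homogeneity of the moments, with |c| = 1 the invariance under rotations. *)
Lemma ge0_integral_Cn_scale n c (f : 'rV[R[i]]_n -> \bar R) : c != 0%R ->
  measurable_fun setT f -> (forall z, 0 <= f z) ->
  \int[@lebesgue_Cn R n]_z f z =
  (sqnormc c ^+ n)%:E * \int[@lebesgue_Cn R n]_z f (c *: z).
Proof.
move=> c0 mf f0.
have ms := measurableT_comp mf (@measurable_Cn_scale n c).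
rewrite (ge0_integral_Cn mf f0) (ge0_integral_Cn ms (fun z => f0 _)).
have mt := measurableT_comp mf (@measurable_Cn_of_tuple R n).
rewrite (ge0_integral_tuple_mul c0 mt (fun t => f0 _)).
congr (_ * _); apply: eq_integral => t _; congr f.
apply/rowP => i; rewrite !mxE tnth_map /plane_mul/=.
by case: c (tnth t i) {c0 ms mt} => a b [x y] /=; simpc; congr (_ +i* _)%R; ring.
Qed.

End Cn_integral.

Section tuple_box.
Local Open Scope ereal_scope.

Lemma measurable_tuple_box d (T : measurableType d) n (Q : 'I_n -> set T) :
  (forall i, measurable (Q i)) ->
  measurable [set t : n.-tuple T | forall i, Q i (tnth t i)].
Proof.
move=> mQ.
rewrite (_ : [set t | _] = \big[setI/setT]_(i < n) ((@tnth n T ^~ i) @^-1` Q i)); last first.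
  apply/seteqP; split => t; rewrite -bigcap_seq /= => tQ i; first by move=> _; exact: tQ.
  by apply: (tQ i); exact: mem_index_enum.
apply: bigsetI_measurable => i _.
by rewrite -[X in measurable X]setTI; exact: measurable_tnth.
Qed.

Lemma tuple_measure_box d (T : measurableType d) (R : realType)
    (m : {sigma_finite_measure set T -> \bar R}) n (Q : 'I_n -> set T) :
  (forall i, measurable (Q i)) ->
  tuple_measure m n [set t | forall i, Q i (tnth t i)] = \prod_(i < n) m (Q i).
Proof.
elim: n => [|n IH] in Q * => mQ.
  rewrite big_ord0 /=/tuple_measure0/= diracE (_ : _ \in _ = true)//.
  by apply/mem_set => -[].
rewrite big_ord_recl -(IH (fun i => Q (lift ord0 i)))//.
transitivity ((m \x tuple_measure m n)
  (Q ord0 `*` [set t | forall i, Q (lift ord0 i) (tnth t i)])).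
  rewrite /=/tuple_measureS /pushforward /sigma_finite_product; congr product_measure1.
  apply/seteqP; split => -[p t] /= tQ.
    split; first exact: (tQ ord0).
    by move=> i; have := tQ (lift ord0 i); rewrite tnthS.
  move=> i; case: (unliftP ord0 i) => [j ->|->]; last exact: tQ.1.
  by rewrite tnthS; exact: tQ.2.
rewrite product_measure1E//.
by apply: (@measurable_tuple_box _ T n (fun i => Q (lift ord0 i))) => i; exact: mQ.
Qed.

End tuple_box.

Section Cn_measure.
Context {R : realType}.
Local Notation T := (measurableTypeR R * measurableTypeR R)%type.
Local Open Scope ereal_scope.

Lemma measurable_Cn_box n (Q : 'I_n -> set T) :
  (forall i, measurable (Q i)) ->
  measurable [set z : 'rV[R[i]]_n | forall i, Q i (Cn_coord i z)].
Proof.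
move=> mQ.
rewrite (_ : [set t | _] = \big[setI/setT]_(i < n) (@Cn_coord R n i @^-1` Q i)); last first.
  apply/seteqP; split => t; rewrite -bigcap_seq /= => tQ i; first by move=> _; exact: tQ.
  by apply: (tQ i); exact: mem_index_enum.
apply: bigsetI_measurable => i _.
by rewrite -[X in measurable X]setTI; exact: measurable_Cn_coord.
Qed.

Lemma lebesgue_Cn_box n (Q : 'I_n -> set T) :
  (forall i, measurable (Q i)) ->
  @lebesgue_Cn R n [set z | forall i, Q i (Cn_coord i z)] =
  \prod_(i < n) lebesgue_plane R (Q i).
Proof.
move=> mQ; rewrite -tuple_measure_box// /lebesgue_Cn /pushforward.
congr (tuple_measure _ _ _).
apply/seteqP; split => t /= tQ i; have := tQ i; rewrite /Cn_coord mxE/=;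
  by case: (tnth t i).
Qed.

Lemma lebesgue_plane_rectangle (a b c d : R) : (a <= b)%R -> (c <= d)%R ->
  lebesgue_plane R (`[a, b]%classic `*` `[c, d]%classic) =
  ((b - a) * (d - c))%:E.
Proof.
move=> ab cd.
rewrite /lebesgue_plane/= /sigma_finite_product product_measure1E//.
have E x y : (x <= y)%R -> @lebesgue_measure R `[x, y]%classic = (y - x)%:E.
  rewrite lebesgue_measure_itv/= lte_fin le_eqVlt => /predU1P[->|->//].
  by rewrite ltxx subrr.
by rewrite [X in X * _]E// [X in _ * X]E.
Qed.

(** The scaling formula is for nonnegative functions, so it is applied to the positive and negative
    parts of f extended by 0 outside the invariant set D. *)
Lemma integral_Cn_rotate n (c : R[i]) (D : set 'rV[R[i]]_n) (f : 'rV[R[i]]_n -> \bar R) :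
  sqnormc c = 1%R -> measurable D -> measurable_fun D f ->
  (forall z, D (c *: z) <-> D z) ->
  \int[@lebesgue_Cn R n]_(z in D) f (c *: z) = \int[@lebesgue_Cn R n]_(z in D) f z.
Proof.
move=> c1 mD mf cD.
have c0 : c != 0%R.
  apply: contra_eq_neq c1 => ->; rewrite /sqnormc/= expr0n/= addr0.
  by rewrite eq_sym oner_eq0.
have mfD : measurable_fun setT (f \_ D) by exact/(measurable_restrictT _ mD).
have inv g : measurable_fun setT g -> (forall z, 0 <= g z) ->
    \int[@lebesgue_Cn R n]_z g (c *: z) = \int[@lebesgue_Cn R n]_z g z.
  by move=> mg g0; rewrite (ge0_integral_Cn_scale c0 mg g0) c1 expr1n mul1e.
rewrite integral_mkcond [RHS]integral_mkcond.
rewrite (_ : (_ \_ D) = (f \_ D) \o (fun z => c *: z)); last first.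
  apply/funext => z; rewrite /patch/=.
  by rewrite (_ : (c *: z \in D) = (z \in D))//; apply/asbool_equiv_eq; exact: cD.
rewrite integralE [RHS]integralE funepos_comp funeneg_comp.
by congr (_ - _); [apply: (inv (f \_ D)^\+)|apply: (inv (f \_ D)^\-)] => //;
  [exact: measurable_funepos|exact: measurable_funeneg].
Qed.

End Cn_measure.

(** * Smooth test functions *)

Section flat.
Context {R : realType}.

(* s^(-m) exp(-1/s), extended by 0: closed under differentiation up to linear
   combinations. *)
Definition flat (m : nat) (s : R) : R := if 0 < s then s ^- m * expR (- s^-1) else 0.

Lemma flat_le0 m s : s <= 0 -> flat m s = 0.
Proof. by rewrite leNgt /flat => /negbTE ->. Qed.

Lemma flat_ge0 m s : 0 <= flat m s.
Proof.
rewrite /flat; case: ifPn => // s0.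
by rewrite mulr_ge0 ?expR_ge0// invr_ge0 exprn_ge0// ltW.
Qed.

Lemma flatS m s : flat m s = flat m.+1 s * s.
Proof.
rewrite /flat; case: ifPn => [s0|]; last by rewrite mul0r.
by rewrite exprSr; field; rewrite gt_eqF//= expf_neq0// gt_eqF.
Qed.

Lemma expRN_inv_le n (s : R) : 0 < s -> expR (- s^-1) <= n.+1`!%:R * s ^+ n.+1.
Proof.
move=> s0; rewrite expRN -lef_pV2 ?posrE ?invr_gt0 ?expR_gt0//; last first.
  by rewrite mulr_gt0 ?ltr0n ?fact_gt0 ?exprn_gt0.
rewrite invrK (le_trans _ (expR_ge1Dxn n _))// ?invr_ge0 ?ltW//.
by rewrite invfM -exprVn mulrC ltrDr.
Qed.

(** Since exp(1/s) exceeds each term of its series, every [flat m] vanishes at 0 faster than any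
    power. This gives differentiability at 0. *)
Lemma flat_le m n s : flat m s <= (m + n).+1`!%:R * `|s| ^+ n.+1.
Proof.
rewrite /flat; case: ifPn => [s0|_]; last by rewrite mulr_ge0.
rewrite gtr0_norm// mulrC ler_pdivrMr ?exprn_gt0// -mulrA -exprD.
by rewrite addSn addnC; exact: expRN_inv_le.
Qed.

Lemma flat_le_fact n s : flat n.+1 s <= n.+1`!%:R.
Proof.
rewrite /flat; case: ifPn => // s0.
by rewrite mulrC ler_pdivrMr ?exprn_gt0// expRN_inv_le.
Qed.

Lemma flat0_ge s : 1 <= s -> expR (-1) <= flat 0 s.
Proof.
move=> s1; have s0 : 0 < s by exact: lt_le_trans s1.
by rewrite /flat s0 expr0 invr1 mul1r ler_expR lerN2 invf_le1.
Qed.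

Lemma flat0_le1 s : flat 0 s <= 1.
Proof.
rewrite /flat; case: ifPn => // s0.
by rewrite expr0 invr1 mul1r expR_le1 oppr_le0 invr_ge0 ltW.
Qed.

Lemma is_derive_flat m (s : R) :
  is_derive s 1 (flat m) (flat m.+2 s - m%:R * flat m.+1 s).
Proof.
have [s0|s0|->] := ltgtP s 0.
- rewrite !flat_le0 ?ltW// mulr0 subr0.
  apply: (@near_eq_is_derive _ _ _ (cst 0)) => //.
  by near=> t; rewrite /= flat_le0// ltW//; near: t; exact: lt_nbhsl.
- have sn0 : s != 0 by rewrite gt_eqF.
  apply: (@near_eq_is_derive _ _ _ ((fun t : R => t^-1) ^+ m * (expR \o (fun t : R => - t^-1)))).
    near=> t; rewrite /flat ifT; last by near: t; exact: lt_nbhsr.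
    by rewrite fctE/= -exprVn; congr (_ * _); elim: (m) => [|k IH] //; rewrite !exprS -IH.
  have dV : is_derive s 1 (fun t : R => t^-1) (- s ^- 2).
    apply: (is_derive_eq (@is_deriveV R id s 1 1 sn0 (is_derive_id _ _))).
    by rewrite /GRing.scale/= mulr1.
  have dN : is_derive s 1 (fun t : R => - t^-1) (s ^- 2).
    by rewrite -[X in is_derive _ _ _ X]opprK; exact: is_deriveN.
  have dE := @is_derive1_comp R expR (fun t : R => - t^-1) s _ _ (is_derive_expR _) dN.
  apply: is_derive_eq; rewrite /flat s0 /GRing.scale /= exprfctE /=.
  case: m => [|m].
    by rewrite /= !mul0r mulr0 subr0 expr0 mul1r addr0 mulrC.
  by rewrite /= !exprVn !exprS; field; rewrite sn0 expf_neq0.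
- rewrite !flat_le0// mulr0 subr0.
  (* By [flatS] the slope of [flat m] between 0 and s is [flat m.+1 s]; it is continuous at 0 by
     [flat_le] with exponent 1, and its value there is 0. *)
  apply/is_derive1_caratheodory; exists (flat m.+1); split.
  + by move=> z; rewrite subr0 (flat_le0 _ (lexx 0)) subr0 -flatS.
  + apply/cvgrPdist_le => e e0; rewrite (flat_le0 _ (lexx 0)).
    have c0 : 0 < (m.+1 + 0).+1`!%:R :> R by rewrite ltr0n fact_gt0.
    near=> t; rewrite sub0r normrN ger0_norm ?flat_ge0// (le_trans (flat_le _ 0 _))//.
    rewrite mulrC -ler_pdivlMr// expr1; near: t.
    by apply: (@nbhs0_le R R^o); rewrite divr_gt0.
  + exact: flat_le0.
Unshelve. all: end_near. Qed.
End flat.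

Section complex_continuity.
Context {R : realType}.
Local Notation C := R[i].

Lemma continuous_Re : continuous (@complex.Re R : C -> R).
Proof.
move=> x; apply/(cvgrPdist_lt (FF := nbhs_filter x)) => e e0.
have e0C : (0 : C) < e%:C by rewrite ltcR.
apply: filterS (nbhsx_ballx x e%:C e0C) => y xy.
by rewrite -ltcR -raddfB; apply: le_lt_trans (normc_ge_Re _) _.
Qed.

Lemma continuous_Im : continuous (@complex.Im R : C -> R).
Proof.
move=> x; apply/(cvgrPdist_lt (FF := nbhs_filter x)) => e e0.
have e0C : (0 : C) < e%:C by rewrite ltcR.
apply: filterS (nbhsx_ballx x e%:C e0C) => y xy.
rewrite -ltcR -raddfB -normrN -ReiNIm; apply: le_lt_trans (normc_ge_Re _) _.
by rewrite normrM (_ : `|'i%C| = 1) ?mulr1// normc_def/= expr0n add0r expr1n sqrtr1.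
Qed.

Lemma continuous_conjc : continuous (@conjc R : C -> C).
Proof.
move=> x; apply/(cvgrPdist_lt (FF := nbhs_filter x)) => e e0.
by apply: filterS (nbhsx_ballx x e e0) => y xy; rewrite -raddfB normcJ.
Qed.

Lemma continuous_real_complex : continuous (real_complex R : R -> C).
Proof.
move=> x; apply/(cvgrPdist_lt (FF := nbhs_filter x)) => e e0.
have eE : e = (complex.Re e)%:C by rewrite RRe_real ?gtr0_real.
have e'0 : 0 < complex.Re e by rewrite -ltcR -eE.
apply: filterS (nbhsx_ballx x _ e'0) => y xy.
by rewrite -raddfB eE normc_def/= expr0n addr0 sqrtr_sqr ltcR.
Qed.

End complex_continuity.

Lemma is_derive_quadratic {R : realType} (a b c : R) :
  is_derive (0 : R) 1 (fun t : R => a + t * b + t ^+ 2 * c) b.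
Proof.
pose p : {poly R} := a%:P + b%:P * 'X + c%:P * 'X^2.
rewrite (_ : (fun t => _) = horner p); last first.
  by apply/funext => t; rewrite /p !hornerE /=; ring.
apply: (is_derive_eq (is_derive_poly p 0)).
by rewrite /p !poly.derivE !hornerE /= mulr0 mul0r addr0.
Qed.

Section smooth.
Context {R : realType} {n : nat}.
Local Notation C := R[i].
Local Notation Cn := 'rV[C]_n.
Implicit Types (phi psi f g : Cn -> C) (v z : Cn).

(** Carries derivability together with the value, so that a candidate derivative can be supplied
    explicitly and the sum and product rules compose. *)
Definition has_real_deriv v phi psi : Prop := forall z,
  is_derive (0 : R) 1 (fun t : R => complex.Re (phi (z + t%:C *: v))) (complex.Re (psi z)) /\
  is_derive (0 : R) 1 (fun t : R => complex.Im (phi (z + t%:C *: v))) (complex.Im (psi z)).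

Lemma has_real_derivP v phi psi : has_real_deriv v phi psi <->
  (forall z, real_derivable v phi z) /\ real_deriv v phi = psi.
Proof.
split=> [h|[h <-] z].
  split=> [z|]; first by have [[d1 _] [d2 _]] := h z; exact: (conj d1 d2).
  apply/funext => z; rewrite /real_deriv !derive1E.
  have [d1 d2] := h z; rewrite !derive_val; by case: (psi z).
rewrite /real_deriv /= !derive1E; have [d1 d2] := h z.
exact: (conj (derivableP d1) (derivableP d2)).
Qed.

Lemma real_CkS k phi : continuous phi ->
  (forall v, exists2 psi, has_real_deriv v phi psi & real_Ck k psi) ->
  real_Ck k.+1 phi.
Proof.
move=> cphi h; split=> // v; have [psi /has_real_derivP[h1 <-] h2] := h v.
by split.
Qed.

Lemma real_CkS_deriv k phi v : real_Ck k.+1 phi ->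
  has_real_deriv v phi (real_deriv v phi) /\ real_Ck k (real_deriv v phi).
Proof. by move=> [_ /(_ v)[h1 h2]]; split; [apply/has_real_derivP; split|exact: h2]. Qed.

Lemma real_Ck_continuous k phi : real_Ck k phi -> continuous phi.
Proof. by case: k => [|k] []. Qed.

(** Serves the product rule: each summand contains one undifferentiated factor, which is one order
    smoother than the induction hypothesis asks for. *)
Lemma real_Ck_pred k phi : real_Ck k.+1 phi -> real_Ck k phi.
Proof.
elim: k phi => [|k IH] phi; first by move=> /real_Ck_continuous.
move=> h; apply: real_CkS; first exact: real_Ck_continuous h.
move=> v; have [h1 h2] := real_CkS_deriv v h.
by exists (real_deriv v phi) => //; exact: IH.
Qed.

Lemma has_real_derivD v f g df dg : has_real_deriv v f df -> has_real_deriv v g dg ->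
  has_real_deriv v (f \+ g) (df \+ dg).
Proof.
move=> hf hg z; have [f1 f2] := hf z; have [g1 g2] := hg z.
rewrite /= !raddfD /=.
split; (under eq_fun do rewrite raddfD /=); exact: is_deriveD.
Qed.

Lemma has_real_derivM v f g df dg : has_real_deriv v f df -> has_real_deriv v g dg ->
  has_real_deriv v (f \* g) (fun z => df z * g z + f z * dg z).
Proof.
have ReD (a b : C) : complex.Re (a + b) = complex.Re a + complex.Re b.
  by case: a b => ? ? [].
have ImD (a b : C) : complex.Im (a + b) = complex.Im a + complex.Im b.
  by case: a b => ? ? [].
have ReM (a b : C) : complex.Re (a * b) =
    complex.Re a * complex.Re b - complex.Im a * complex.Im b.
  by case: a b => ? ? [].
have ImM (a b : C) : complex.Im (a * b) =
    complex.Re a * complex.Im b + complex.Im a * complex.Re b.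
  by case: a b => ? ? [].
move=> hf hg z; have [f1 f2] := hf z; have [g1 g2] := hg z.
split.
  under eq_fun do rewrite ReM.
  apply: (is_derive_eq (is_deriveB (is_deriveM f1 g1) (is_deriveM f2 g2))).
  by rewrite rmorph0 scale0r addr0 ReD !ReM /GRing.scale /=; ring.
under eq_fun do rewrite ImM.
apply: (is_derive_eq (is_deriveD (is_deriveM f1 g2) (is_deriveM f2 g1))).
by rewrite rmorph0 scale0r addr0 ImD !ImM /GRing.scale /=; ring.
Qed.

Lemma real_CkD k f g : real_Ck k f -> real_Ck k g -> real_Ck k (f \+ g).
Proof.
have cD f' g' : continuous f' -> continuous g' -> continuous (f' \+ g' : Cn -> C).
  by move=> cf cg z; exact: continuousD (cf z) (cg z).
elim: k f g => [|k IH] f g hf hg.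
  by split => //; apply: cD; [exact: hf.1|exact: hg.1].
apply: real_CkS; first by apply: cD; [exact: real_Ck_continuous hf|exact: real_Ck_continuous hg].
move=> v; have [f1 f2] := real_CkS_deriv v hf; have [g1 g2] := real_CkS_deriv v hg.
by exists (real_deriv v f \+ real_deriv v g); [exact: has_real_derivD|exact: IH].
Qed.

Lemma real_CkM k f g : real_Ck k f -> real_Ck k g -> real_Ck k (f \* g).
Proof.
have cM f' g' : continuous f' -> continuous g' -> continuous (f' \* g' : Cn -> C).
  by move=> cf cg z; exact: continuousM (cf z) (cg z).
elim: k f g => [|k IH] f g hf hg.
  by split => //; apply: cM; [exact: hf.1|exact: hg.1].
apply: real_CkS; first by apply: cM; [exact: real_Ck_continuous hf|exact: real_Ck_continuous hg].
move=> v; have [f1 f2] := real_CkS_deriv v hf; have [g1 g2] := real_CkS_deriv v hg.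
exists (fun z => real_deriv v f z * g z + f z * real_deriv v g z).
  exact: has_real_derivM.
have hf' := real_Ck_pred hf; have hg' := real_Ck_pred hg.
exact: (real_CkD (IH _ _ f2 hg') (IH _ _ hf' g2)).
Qed.

Lemma has_real_deriv_cst v (c : C) : has_real_deriv v (fun=> c) (fun=> 0 : C).
Proof. by move=> z; split; exact: is_derive_cst. Qed.

Lemma real_Ck_cst k (c : C) : real_Ck k (fun _ : Cn => c).
Proof.
have cc (c' : C) : continuous (fun _ : Cn => c') by exact: cst_continuous.
elim: k c => [|k IH] c; first by split; [exact: cc|].
apply: real_CkS; first exact: cc.
by move=> v; exists (fun=> 0); [exact: has_real_deriv_cst|exact: IH].
Qed.

Lemma real_CkX k f m : real_Ck k f -> real_Ck k (fun z => f z ^+ m).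
Proof.
move=> hf; elim: m => [|m IH]; first exact: real_Ck_cst.
under eq_fun do rewrite exprS; exact: real_CkM.
Qed.

Lemma has_real_deriv_linear v (L : Cn -> C) :
  (forall (t : R) z w, L (z + t%:C *: w) = L z + t%:C * L w) ->
  has_real_deriv v L (fun=> L v).
Proof.
have aff (a b : R) : is_derive (0 : R) 1 (fun t : R => a + t * b) b.
  by have := is_derive_quadratic a b 0; under eq_fun do rewrite mulr0 addr0.
have ReL (t : R) (c : C) : complex.Re (t%:C * c) = t * complex.Re c.
  by case: c => a b /=; rewrite mul0r subr0.
have ImL (t : R) (c : C) : complex.Im (t%:C * c) = t * complex.Im c.
  by case: c => a b /=; rewrite mul0r addr0.
move=> hL z; split.
  by under eq_fun do rewrite hL raddfD /= ReL.
by under eq_fun do rewrite hL raddfD /= ImL.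
Qed.

Lemma real_Ck_linear k (L : Cn -> C) : continuous L ->
  (forall (t : R) z w, L (z + t%:C *: w) = L z + t%:C * L w) -> real_Ck k L.
Proof.
move=> cL hL; case: k => [|k]; first by split.
apply: real_CkS => // v; exists (fun=> L v); first exact: has_real_deriv_linear.
exact: real_Ck_cst.
Qed.

Definition sqnormv (z : Cn) : R := \sum_j sqnormc (z ord0 j).

(** The inner product of R^(2n). Twice its value is the derivative of [sqnormv] at z along w. *)
Definition real_dot (z w : Cn) : R :=
  \sum_j (complex.Re (z ord0 j) * complex.Re (w ord0 j) +
          complex.Im (z ord0 j) * complex.Im (w ord0 j)).

Lemma sqnormv_line z v (t : R) :
  sqnormv (z + t%:C *: v) = sqnormv z + 2 * t * real_dot z v + t ^+ 2 * sqnormv v.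
Proof.
rewrite /sqnormv /real_dot 2!mulr_sumr -!big_split; apply: eq_bigr => j _.
by rewrite !mxE /sqnormc; case: (z ord0 j) (v ord0 j) => a b [c d]/=; ring.
Qed.

Lemma real_dot_line z v (t : R) w :
  real_dot (z + t%:C *: v) w = real_dot z w + t * real_dot v w.
Proof.
rewrite /real_dot mulr_sumr -!big_split; apply: eq_bigr => j _.
by rewrite !mxE; case: (z ord0 j) (v ord0 j) => a b [c d]/=; ring.
Qed.

Lemma continuous_Re_coord j : continuous (fun z : Cn => complex.Re (z ord0 j)).
Proof.
move=> z; apply: (@continuous_comp Cn C R (fun z => z ord0 j)); first exact: coord_continuous.
exact: continuous_Re.
Qed.

Lemma continuous_Im_coord j : continuous (fun z : Cn => complex.Im (z ord0 j)).
Proof.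
move=> z; apply: (@continuous_comp Cn C R (fun z => z ord0 j)); first exact: coord_continuous.
exact: continuous_Im.
Qed.

Lemma continuous_addR (f g : Cn -> R) :
  continuous f -> continuous g -> continuous (fun z => f z + g z).
Proof. by move=> cf cg z; exact: continuousD (cf z) (cg z). Qed.

Lemma continuous_mulR (f g : Cn -> R) :
  continuous f -> continuous g -> continuous (fun z => f z * g z).
Proof. by move=> cf cg z; exact: continuousM (cf z) (cg z). Qed.

Lemma continuous_sumR (I : Type) (r : seq I) (F : I -> Cn -> R) :
  (forall i, continuous (F i)) -> continuous (fun z => \sum_(i <- r) F i z).
Proof.
move=> cF; elim: r => [|i r IH].
  by under eq_fun do rewrite big_nil; exact: cst_continuous.
under eq_fun do rewrite big_cons; exact: continuous_addR.
Qed.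

Lemma continuous_sqnormv : continuous sqnormv.
Proof.
apply: continuous_sumR => j; rewrite /sqnormc.
under eq_fun do rewrite !expr2.
by apply: continuous_addR; apply: continuous_mulR;
  [exact: continuous_Re_coord..|exact: continuous_Im_coord|exact: continuous_Im_coord].
Qed.

Lemma continuous_real_dot w : continuous (real_dot ^~ w).
Proof.
apply: continuous_sumR => j.
by apply: continuous_addR; apply: continuous_mulR;
  [exact: continuous_Re_coord|exact: cst_continuous|
   exact: continuous_Im_coord|exact: cst_continuous].
Qed.

Lemma continuous_comp_real_complex (f : Cn -> R) : continuous f ->
  continuous (fun z => (f z)%:C : C).
Proof.
move=> cf z; apply: (@continuous_comp Cn R C f); first exact: cf.
exact: continuous_real_complex.
Qed.

Lemma real_Ck_real_dot k w : real_Ck k (fun z => (real_dot z w)%:C).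
Proof.
apply: real_Ck_linear.
  by apply: continuous_comp_real_complex; exact: continuous_real_dot.
by move=> t z v; rewrite real_dot_line; simpc.
Qed.

(** Along a real line [sqnormv] is quadratic in t, so the chain rule applies to [is_derive_flat].
    The result is again built from functions [flat] and a real linear function, which closes the
    induction in [real_Ck_flat]. *)
Lemma has_real_deriv_flat K m v :
  has_real_deriv v (fun z => (flat m (K * (1 - sqnormv z) - 1))%:C)
    (fun z => (flat m.+2 (K * (1 - sqnormv z) - 1) -
               m%:R * flat m.+1 (K * (1 - sqnormv z) - 1))%:C *
              ((- 2 * K)%:C * (real_dot z v)%:C)).
Proof.
move=> z; split; last by rewrite -!rmorphM /=; exact: is_derive_cst.
rewrite -!rmorphM /=.
set s := K * (1 - sqnormv z) - 1.
pose q t := K * (1 - sqnormv (z + t%:C *: v)) - 1.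
have dq : is_derive (0 : R) 1 q (- 2 * K * real_dot z v).
  rewrite (_ : q = fun t => s + t * (- 2 * K * real_dot z v) + t ^+ 2 * (- K * sqnormv v)).
    exact: is_derive_quadratic.
  by apply/funext => t; rewrite /q /s sqnormv_line; ring.
have q0 : q 0 = s by rewrite /q rmorph0 scale0r addr0.
have := @is_derive1_comp R (flat m) q 0 _ _ (is_derive_flat m _) dq.
by rewrite q0.
Qed.

Lemma continuous_flat m : continuous (@flat R m).
Proof.
move=> s; apply: differentiable_continuous; apply/derivable1_diffP.
by have [] := is_derive_flat m s.
Qed.

Lemma real_Ck_flat K k m : real_Ck k (fun z => (flat m (K * (1 - sqnormv z) - 1))%:C).
Proof.
have cq : continuous (fun z => K * (1 - sqnormv z) - 1).
  rewrite (_ : (fun z => _) = fun z => (K - 1) + - K * sqnormv z); last first.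
    by apply/funext => z; ring.
  apply: continuous_addR; first exact: cst_continuous.
  by apply: continuous_mulR; [exact: cst_continuous|exact: continuous_sqnormv].
have cf m' : continuous (fun z => (flat m' (K * (1 - sqnormv z) - 1))%:C : C).
  apply: continuous_comp_real_complex => z.
  by apply: (@continuous_comp Cn R R _ (flat m')); [exact: cq|exact: continuous_flat].
elim: k m => [|k IH] m; first by split => //; exact: cf.
apply: real_CkS => // v; eexists; first exact: has_real_deriv_flat.
apply: real_CkM; last first.
  by apply: real_CkM; [exact: real_Ck_cst|exact: real_Ck_real_dot].
rewrite (_ : (fun z => _) = (fun z => (flat m.+2 (K * (1 - sqnormv z) - 1))%:C) \+
  ((fun=> (- m%:R)%:C) \* (fun z => (flat m.+1 (K * (1 - sqnormv z) - 1))%:C))).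
  by apply: real_CkD => //; apply: real_CkM => //; exact: real_Ck_cst.
by apply/funext => z; apply/eqP; rewrite eq_complex /=; apply/andP; split; apply/eqP; ring.
Qed.

Lemma real_Ck_conj_coord k j : real_Ck k (fun z => (z ord0 j)^*).
Proof.
apply: real_Ck_linear => [z|t z w].
  apply: (@continuous_comp Cn C C (fun z => z ord0 j)); first exact: coord_continuous.
  exact: continuous_conjc.
by rewrite !mxE rmorphD rmorphM /= oppr0.
Qed.

End smooth.

(** * Radial bumps supported in the ball and their dbar derivatives *)

Section test_functions.
Context {R : realType} {n : nat}.
Local Notation C := R[i].
Local Notation Cn := 'rV[C]_n.

Lemma unit_ballE (z : Cn) : unit_ball z <-> sqnormv z < 1.
Proof.
rewrite /unit_ball/= -(ltcR _ 1) /sqnormv rmorph_sum /=.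
by under [in X in _ <-> X]eq_bigr do rewrite add_Re2_Im2.
Qed.

Lemma compact_square : compact [set c : C | `|complex.Re c| <= 1 /\ `|complex.Im c| <= 1].
Proof.
pose f (p : R * R) : C := p.1 +i* p.2.
have cf : continuous f.
  move=> p; rewrite (_ : f = (fun p => (p.1)%:C + 'i%C * (p.2)%:C)); last first.
    by apply/funext => -[x y]; rewrite /f /=; simpc.
  apply: cvgD.
    apply: (@continuous_comp _ R C fst); first exact: cvg_fst.
    exact: continuous_real_complex.
  apply: cvgM; first exact: cvg_cst.
  apply: (@continuous_comp _ R C snd); first exact: cvg_snd.
  exact: continuous_real_complex.
rewrite (_ : [set c | _] = f @` (`[-1, 1] `*` `[-1, 1])); last first.
  apply/seteqP; split=> [[x y] /= [xle yle]|_ [[x y] /= [xI yI] <-]/=].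
    by exists (x, y) => //=; rewrite !in_itv /= -!ler_norml.
  by move: xI yI; rewrite !in_itv /= -!ler_norml.
apply: continuous_compact; first exact: continuous_subspaceT.
by apply: compact_setX; exact: segment_compact.
Qed.

Lemma compact_sqnormv_le (r : R) : r <= 1 -> compact [set z : Cn | sqnormv z <= r].
Proof.
move=> r1.
have cl : closed [set z : Cn | sqnormv z <= r].
  have -> : [set z : Cn | sqnormv z <= r] = sqnormv @^-1` [set x | x <= r] by [].
  apply: closed_comp; last exact: closed_le.
  by move=> z _; exact: continuous_sqnormv.
apply: (subclosed_compact cl (rV_compact (fun=> compact_square))).
move=> z /= zr j /=.
have sq1 (x : R) : x ^+ 2 <= 1 -> `|x| <= 1.
  by move=> x1; rewrite -(@ler_pXn2r _ 2)// ?nnegrE// expr1n real_normK ?num_real.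
have zj : sqnormc (z ord0 j) <= 1.
  apply: le_trans r1; apply: le_trans zr.
  by rewrite /sqnormv (bigD1 j)//= lerDl sumr_ge0// => i _; rewrite addr_ge0// sqr_ge0.
by split; apply: sq1; apply: le_trans zj; rewrite /sqnormc ?lerDl ?lerDr sqr_ge0.
Qed.

(** For K > 0 the cutoff vanishes when |z|^2 >= 1 - 1/K and is at least exp(-1) when |z|^2 <= 1 -
    2/K. The power of conj(z_i) makes the product with z_i^k nonnegative. *)
Definition radial_bump (i : 'I_n) (k : nat) (K : R) (z : Cn) : C :=
  (z ord0 i)^* ^+ k * (flat 0 (K * (1 - sqnormv z) - 1))%:C.

Lemma test_function_bump i k K : 0 < K -> test_function (@unit_ball R n) (radial_bump i k K).
Proof.
move=> K0; split.
  move=> m; apply: real_CkM; last exact: real_Ck_flat.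
  by apply: real_CkX; exact: real_Ck_conj_coord.
have K1 : 1 - K^-1 < 1 by rewrite ltrBlDr ltrDl invr_gt0.
exists [set z : Cn | sqnormv z <= 1 - K^-1].
  split; first by apply: compact_sqnormv_le; exact: ltW.
  by move=> z /= zK; apply/unit_ballE; exact: le_lt_trans K1.
move=> z /= /negP; rewrite -ltNge => zK.
rewrite /radial_bump flat_le0 ?mulr0// subr_le0 -ler_pdivlMl// mulr1.
by rewrite lerBlDr -lerBlDl ltW.
Qed.

Lemma real_dot_delta (z : Cn) j : real_dot z (delta_mx ord0 j) = complex.Re (z ord0 j).
Proof.
rewrite /real_dot (bigD1 j)//= big1 => [|i ij]; rewrite !mxE /=.
  by rewrite eqxx /= mulr1 mulr0 !addr0.
by rewrite (negbTE ij) /= !mulr0 addr0.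
Qed.

Lemma real_dot_idelta (z : Cn) j :
  real_dot z ('i%C *: delta_mx ord0 j) = complex.Im (z ord0 j).
Proof.
rewrite /real_dot (bigD1 j)//= big1 => [|i ij]; rewrite !mxE /=.
  by rewrite eqxx mulr1 /= mulr0 add0r mulr1 addr0.
by rewrite (negbTE ij) mulr0 /= !mulr0 addr0.
Qed.

(** The hypothesis on v makes the power of conj(z_i) constant along the line, so only the cutoff is
    differentiated, and [flat 0] has derivative [flat 2]. *)
Lemma real_deriv_bump i k K (v z : Cn) : v ord0 i = 0 ->
  real_deriv v (radial_bump i k K) z =
  (z ord0 i)^* ^+ k * (flat 2 (K * (1 - sqnormv z) - 1))%:C *
  ((- 2 * K)%:C * (real_dot z v)%:C).
Proof.
move=> vi.
have h1 : has_real_deriv v (fun z => (z ord0 i)^* ^+ k) (fun=> 0).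
  by move=> w; split; (under eq_fun do rewrite !mxE vi mulr0 addr0); exact: is_derive_cst.
have /has_real_derivP[_ ->] := has_real_derivM h1 (has_real_deriv_flat K 0 v).
by rewrite mul0r add0r mul0r subr0 mulrA.
Qed.

(** Half of (-2 K Re z_j) + i (-2 K Im z_j) is -K z_j, the factor from which the gain comes. *)
Lemma dbar_deriv_bump i j k K z : j != i ->
  dbar_deriv j (radial_bump i k K) z =
  (z ord0 i)^* ^+ k * (flat 2 (K * (1 - sqnormv z) - 1))%:C * (- K%:C * z ord0 j).
Proof.
move=> ji.
have d0 : (delta_mx ord0 j : Cn) ord0 i = 0 by rewrite mxE (eq_sym i) (negbTE ji) andbF.
rewrite /dbar_deriv !real_deriv_bump; [|by rewrite mxE d0 mulr0|exact: d0].
rewrite real_dot_delta real_dot_idelta [in RHS](complexE (z ord0 j)).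
rewrite rmorphM rmorphN rmorph_nat /=.
by set a := _ ^+ k * _; field.
Qed.

End test_functions.

(** * Semi-inner products *)

Section sqnormc_lemmas.
Context {R : realType}.
Implicit Types a b : R[i].

Lemma sqnormc_ge0 a : 0 <= sqnormc a.
Proof. by rewrite addr_ge0 ?sqr_ge0. Qed.

Lemma sqnormcM a b : sqnormc (a * b) = sqnormc a * sqnormc b.
Proof. by case: a b => a1 a2 [b1 b2]; rewrite /sqnormc /=; ring. Qed.

Lemma sqnormcJ a : sqnormc a^* = sqnormc a.
Proof. by case: a => a1 a2; rewrite /sqnormc /= sqrrN. Qed.

Lemma sqnormcN a : sqnormc (- a) = sqnormc a.
Proof. by case: a => a1 a2; rewrite /sqnormc /= !sqrrN. Qed.

Lemma sqnormc_real (r : R) : sqnormc r%:C = r ^+ 2.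
Proof. by rewrite /sqnormc /= expr0n addr0. Qed.

Lemma sqnormcD_le a b : sqnormc (a + b) <= 2 * sqnormc a + 2 * sqnormc b.
Proof.
case: a b => a1 a2 [b1 b2]; rewrite /sqnormc /= -subr_ge0.
have -> : 2 * (a1 ^+ 2 + a2 ^+ 2) + 2 * (b1 ^+ 2 + b2 ^+ 2) -
  ((a1 + b1) ^+ 2 + (a2 + b2) ^+ 2) = (a1 - b1) ^+ 2 + (a2 - b2) ^+ 2 by ring.
by rewrite addr_ge0 ?sqr_ge0.
Qed.

Lemma mul_conjc a : a * a^* = (sqnormc a)%:C.
Proof.
case: a => a1 a2; apply/eqP; rewrite eq_complex /= /sqnormc /=.
by apply/andP; split; apply/eqP; ring.
Qed.

Lemma sqnormcX a k : sqnormc (a ^+ k) = sqnormc a ^+ k.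
Proof.
elim: k => [|k IH]; first by rewrite !expr0 /sqnormc /= expr1n expr0n addr0.
by rewrite !exprS sqnormcM IH.
Qed.

End sqnormc_lemmas.

Section inner_product.
Context {R : realType} {V : lmodType R[i]}.
Local Notation C := R[i].

(* A semi-inner product, linear in its first argument, on the subspace H. *)
Record semi_inner (H : set V) (ip : V -> V -> C) : Prop := SemiInner {
  semi_inner0 : H 0 ;
  semi_innerP : forall (a : C) u v, H u -> H v -> H (a *: u + v) ;
  semi_inner_linear : forall (a : C) u v w, H u -> H v -> H w ->
    ip (a *: u + v) w = a * ip u w + ip v w ;
  semi_inner_conj : forall u v, H u -> H v -> ip v u = (ip u v)^* ;
  semi_inner_ge0 : forall u, H u -> 0 <= complex.Re (ip u u) }.

Variables (H : set V) (ip : V -> V -> C).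
Hypothesis ipH : semi_inner H ip.

Let ipD u v w : H u -> H v -> H w -> ip (u + v) w = ip u w + ip v w.
Proof. by move=> Hu Hv Hw; rewrite -[u]scale1r (semi_inner_linear ipH)// mul1r scale1r. Qed.

Lemma semi_inner0l w : H w -> ip 0 w = 0.
Proof.
move=> Hw; have H0 := semi_inner0 ipH; have := ipD H0 H0 Hw.
by rewrite addr0 => /eqP; rewrite -subr_eq0 opprD addrA subrr sub0r oppr_eq0 => /eqP.
Qed.

Lemma semi_innerZ (a : C) u : H u -> H (a *: u).
Proof. by move=> Hu; rewrite -[_ *: _]addr0; exact/(semi_innerP ipH)/(semi_inner0 ipH). Qed.

Lemma semi_innerD u v : H u -> H v -> H (u + v).
Proof. by move=> Hu Hv; rewrite -[u]scale1r; exact/(semi_innerP ipH). Qed.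

Lemma semi_innerB u v : H u -> H v -> H (u - v).
Proof. by move=> Hu Hv; rewrite -scaleN1r; exact/semi_innerD/semi_innerZ. Qed.

Lemma semi_inner_sum (I : eqType) (s : seq I) (F : I -> V) :
  (forall i, i \in s -> H (F i)) -> H (\sum_(i <- s) F i).
Proof.
elim: s => [|i s IH] HF; first by rewrite big_nil; exact: semi_inner0 ipH.
rewrite big_cons; apply: semi_innerD; first by apply: HF; rewrite mem_head.
by apply: IH => j js; apply: HF; rewrite in_cons js orbT.
Qed.

Lemma semi_innerDl u v w : H u -> H v -> H w -> ip (u + v) w = ip u w + ip v w.
Proof. exact: ipD. Qed.

Lemma semi_innerZl (a : C) u w : H u -> H w -> ip (a *: u) w = a * ip u w.
Proof.
move=> Hu Hw; rewrite -[_ *: _]addr0 (semi_inner_linear ipH)//; last exact: semi_inner0 ipH.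
by rewrite semi_inner0l// addr0.
Qed.

Lemma semi_innerBl u v w : H u -> H v -> H w -> ip (u - v) w = ip u w - ip v w.
Proof.
move=> Hu Hv Hw; rewrite -scaleN1r semi_innerDl//; last exact: semi_innerZ.
by rewrite semi_innerZl// mulN1r.
Qed.

Lemma semi_innerBr u v w : H u -> H v -> H w -> ip w (u - v) = ip w u - ip w v.
Proof.
move=> Hu Hv Hw; rewrite (semi_inner_conj ipH (semi_innerB Hu Hv) Hw) semi_innerBl//.
by rewrite rmorphB /= -!(semi_inner_conj ipH).
Qed.

Lemma semi_innerZr (a : C) u w : H u -> H w -> ip w (a *: u) = a^* * ip w u.
Proof.
move=> Hu Hw; rewrite (semi_inner_conj ipH (semi_innerZ a Hu) Hw) semi_innerZl//.
by rewrite rmorphM /= -!(semi_inner_conj ipH).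
Qed.

Lemma semi_inner_suml (I : eqType) (s : seq I) (F : I -> V) w :
  (forall i, i \in s -> H (F i)) -> H w ->
  ip (\sum_(i <- s) F i) w = \sum_(i <- s) ip (F i) w.
Proof.
move=> HF Hw; elim: s => [|i s IH] in HF *; first by rewrite !big_nil semi_inner0l.
have Hs j : j \in s -> H (F j) by move=> js; apply: HF; rewrite in_cons js orbT.
rewrite !big_cons semi_innerDl ?IH//; first by apply: HF; rewrite mem_head.
exact: semi_inner_sum.
Qed.

Lemma semi_inner_sumr (I : eqType) (s : seq I) (F : I -> V) w :
  (forall i, i \in s -> H (F i)) -> H w ->
  ip w (\sum_(i <- s) F i) = \sum_(i <- s) ip w (F i).
Proof.
move=> HF Hw.
rewrite (semi_inner_conj ipH (semi_inner_sum HF) Hw) semi_inner_suml// rmorph_sum /=.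
by apply: eq_big_seq => i si; rewrite -(semi_inner_conj ipH (HF i si) Hw).
Qed.

Lemma semi_inner_Re u : H u -> ip u u = (complex.Re (ip u u))%:C.
Proof.
move=> Hu; have := semi_inner_conj ipH Hu Hu; case: (ip u u) => a b /= [] bE.
apply/eqP; rewrite eq_complex /= eqxx /=; move: bE => /eqP.
by rewrite -subr_eq0 opprK -mulr2n mulrn_eq0.
Qed.

Lemma semi_inner_bessel (N : nat) (psi : nat -> V) (M : nat -> R) u :
  (forall k, H (psi k)) -> (forall k l, k != l -> ip (psi k) (psi l) = 0) ->
  (forall k, 0 < M k) -> (forall k, complex.Re (ip (psi k) (psi k)) <= M k) ->
  H u ->
  \sum_(k < N) sqnormc (ip u (psi k)) / M k <= complex.Re (ip u u).
Proof.
move=> Hpsi orth M0 psiM Hu.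
(* The remainder w after N subtractions pairs with the later psi_l exactly as u does, by
   orthogonality; this lets the induction continue. *)
suff [w [Hw ww wl]] : exists w, [/\ H w, complex.Re (ip w w) <=
      complex.Re (ip u u) - \sum_(k < N) sqnormc (ip u (psi k)) / M k &
    forall l, (N <= l)%N -> ip w (psi l) = ip u (psi l)].
  by rewrite -subr_ge0 (le_trans _ ww)//; exact: semi_inner_ge0 ipH _ Hw.
elim: N => [|N [w [Hw ww wl]]].
  by exists u; split => //; rewrite big_ord0 subr0.
pose a := ip u (psi N); pose b : C := (M N)^-1%:C * a.
have Hb : H (b *: psi N) by exact: semi_innerZ.
have HwB : H (w - b *: psi N) by exact: semi_innerB.
exists (w - b *: psi N); split => //.
  rewrite big_ord_recr /= opprD addrA.
  rewrite semi_innerBl ?semi_innerBr ?semi_innerZl ?semi_innerZr//.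
  rewrite (semi_inner_conj ipH Hw (Hpsi N)) (wl N (leqnn _)) -/a.
  rewrite (semi_inner_Re (Hpsi N)); set p := complex.Re (ip (psi N) (psi N)).
  have -> : complex.Re (ip w w - b^* * a - (b * a^* - b * (b^* * p%:C))) =
     complex.Re (ip w w) - 2 * (sqnormc a / M N) + sqnormc a / M N * (p / M N).
    rewrite /b /sqnormc; case: (ip w w) (a) => [x y] [a1 a2] /=; ring.
  have : sqnormc a / M N * (p / M N) <= sqnormc a / M N.
    rewrite ler_piMr//; first by rewrite divr_ge0 ?sqnormc_ge0// ltW.
    by rewrite ler_pdivrMr ?mul1r ?psiM.
  by move: ww; set x := \sum_(_ < _) _; rewrite -/a; lra.
move=> l Nl; rewrite semi_innerBl// semi_innerZl// orth ?mulr0 ?subr0 ?wl//; first exact: ltnW.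
by rewrite neq_ltn Nl.
Qed.

(** Bessel's inequality for the single vector v, with any positive M >= |v|^2 as its bound. If |v|^2
    = 0, then M is arbitrary, and a small one forces the pairing to vanish. *)
Lemma semi_inner_cauchy_schwarz u v : H u -> H v ->
  sqnormc (ip u v) <= complex.Re (ip u u) * complex.Re (ip v v).
Proof.
move=> Hu Hv; have vv0 := semi_inner_ge0 ipH Hv; have uu0 := semi_inner_ge0 ipH Hu.
have bound M : 0 < M -> complex.Re (ip v v) <= M -> sqnormc (ip u v) <= complex.Re (ip u u) * M.
  move=> M0 vM; rewrite -ler_pdivrMr//.
  have := @semi_inner_bessel 1 (fun k => if k is 0%N then v else 0) (fun=> M) u.
  rewrite big_ord1 /=; apply=> //.
  - by move=> [|k] //=; exact: semi_inner0 ipH.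
  - move=> [|k] [|l] //= _; rewrite ?semi_inner0l//; try exact: semi_inner0 ipH.
    by rewrite (semi_inner_conj ipH (semi_inner0 ipH) Hv) semi_inner0l// rmorph0.
  - by move=> [|k] //=; rewrite semi_inner0l ?ltW//; exact: semi_inner0 ipH.
move: vv0; rewrite le_eqVlt => /predU1P[vv0|vv0]; last exact: bound.
rewrite -vv0 mulr0 leNgt; apply/negP => uv0.
have M0 : 0 < sqnormc (ip u v) / (2 * (complex.Re (ip u u) + 1)).
  by rewrite divr_gt0// mulr_gt0// ltr_wpDl.
have := bound _ M0; rewrite -vv0 => /(_ (ltW M0)).
rewrite mulrCA ler_pMr// => h.
have : complex.Re (ip u u) / (2 * (complex.Re (ip u u) + 1)) < 1.
  by rewrite ltr_pdivrMr ?mulr_gt0 ?ltr_wpDl//; lra.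
by rewrite ltNge h.
Qed.

(* The component of v orthogonal to e_i, i in F, pairs with h as it does with
   h minus any combination of these e_i. *)
Lemma semi_inner_finite_parseval (I : choiceType) (e : I -> V) (h v : V) :
  (forall i, H (e i)) -> (forall i j, ip (e i) (e j) = (i == j)%:R) ->
  (forall eps : R, 0 < eps -> exists (s : seq I) (c : I -> C),
     let w := h - \sum_(i <- s) c i *: e i in complex.Re (ip w w) < eps) ->
  H h -> H v -> 0 < sqnormc (ip h v) ->
  exists s : seq I, forall F : seq I, uniq F -> {subset s <= F} ->
    sqnormc (ip h v) <=
    4 * (complex.Re (ip h h) * \sum_(i <- F) sqnormc (ip (e i) v)).
Proof.
move=> He orth dense Hh Hv hv0; have vv0 := semi_inner_ge0 ipH Hv.
(* Chosen so that eps |v|^2 <= |<h, v>|^2 / 4; the + 1 covers |v| = 0. In |<h, v>|^2 <= 2 |<h,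
   vF>|^2 + 2 |<w, v - vF>|^2 the last term is then at most half of the left side, whence the factor
   4. *)
pose eps := sqnormc (ip h v) / (4 * (complex.Re (ip v v) + 1)).
have eps0 : 0 < eps by rewrite divr_gt0// mulr_gt0// ltr_wpDl.
have [s [c /= wlt]] := dense _ eps0; exists s => F uF sF.
set w := h - _ in wlt.
have Hce i : H (c i *: e i) by exact: semi_innerZ.
have Hsum : H (\sum_(i <- s) c i *: e i) by exact: semi_inner_sum.
have Hw : H w by exact: semi_innerB.
pose vF := \sum_(i <- F) ip v (e i) *: e i.
have HvF : H vF by apply: semi_inner_sum => i _; exact: semi_innerZ.
have HvvF := semi_innerB Hv HvF.
have orthF i : i \in F -> ip (e i) (v - vF) = 0.
  move=> iF; rewrite semi_innerBr// semi_inner_sumr//; last by move=> j _; exact: semi_innerZ.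
  rewrite (bigD1_seq i)//= big1 => [|j ji].
    by rewrite semi_innerZr// orth eqxx mulr1 addr0 (semi_inner_conj ipH Hv (He i)) subrr.
  by rewrite semi_innerZr// orth eq_sym (negbTE ji) mulr0.
(* The vector h - w is a combination of e_i with i in s, hence in F, and v - vF is orthogonal to
   these. *)
have hE : ip h v = ip h vF + ip w (v - vF).
  rewrite semi_innerBl// semi_inner_suml//= [X in _ - X]big1_seq => [|i /= si].
    by rewrite subr0 semi_innerBr// addrC subrK.
  by rewrite semi_innerZl// orthF ?mulr0// sF.
have vFvF : complex.Re (ip vF vF) = \sum_(i <- F) sqnormc (ip (e i) v).
  have -> : ip vF vF = ip vF v.
    have : ip vF (v - vF) = 0.
      rewrite semi_inner_suml//; last by move=> i _; exact: semi_innerZ.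
      by rewrite big1_seq// => i /= iF; rewrite semi_innerZl// orthF// mulr0.
    by rewrite semi_innerBr// => /eqP; rewrite subr_eq0 => /eqP.
  rewrite semi_inner_suml//; last by move=> i _; exact: semi_innerZ.
  rewrite (eq_bigr (fun i => (sqnormc (ip (e i) v))%:C)).
    by rewrite -rmorph_sum.
  move=> i _; rewrite semi_innerZl// (semi_inner_conj ipH (He i) Hv) mulrC.
  exact: mul_conjc.
have vvF : complex.Re (ip (v - vF) (v - vF)) <= complex.Re (ip v v).
  have -> : ip (v - vF) (v - vF) = ip v v - ip vF vF.
    rewrite semi_innerBl// [X in _ - X](_ : _ = 0) ?subr0; last first.
      rewrite semi_inner_suml//; last by move=> i _; exact: semi_innerZ.
      by rewrite big1_seq// => i /= iF; rewrite semi_innerZl// orthF// mulr0.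
    rewrite semi_innerBr//; congr (_ - _).
    have : ip (v - vF) vF = 0.
      rewrite (semi_inner_conj ipH HvF HvvF).
      rewrite semi_inner_suml//; last by move=> i _; exact: semi_innerZ.
      by rewrite big1_seq ?rmorph0// => i /= iF; rewrite semi_innerZl// orthF// mulr0.
    by rewrite semi_innerBl// => /eqP; rewrite subr_eq0 => /eqP.
  have := semi_inner_ge0 ipH HvF; case: (ip v v) (ip vF vF) => [a b] [x y] /=; lra.
have cs1 := semi_inner_cauchy_schwarz Hh HvF.
have cs2 := semi_inner_cauchy_schwarz Hw HvvF.
have := sqnormcD_le (ip h vF) (ip w (v - vF)); rewrite -hE vFvF in cs1 *.
have : complex.Re (ip w w) * complex.Re (ip (v - vF) (v - vF)) <= sqnormc (ip h v) / 4.
  rewrite (le_trans (ler_pM _ _ (ltW wlt) vvF))//; try exact: semi_inner_ge0 ipH _ _.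
  set x := complex.Re (ip v v) in vv0 *; have x1 : 0 < x + 1 by rewrite ltr_wpDl.
  have -> : eps * x = sqnormc (ip h v) / 4 * (x / (x + 1)).
    by rewrite /eps -/x; field; rewrite gt_eqF.
  rewrite ler_piMr ?divr_ge0 ?sqnormc_ge0//.
  by rewrite ler_pdivrMr// mul1r lerDl.
by move: cs1 cs2; lra.
Qed.

End inner_product.

(** * The spaces L2 of functions and of forms *)

Section Cintegral_theory.
Context {R : realType} {n : nat}.
Local Notation C := R[i].
Local Notation Cn := 'rV[C]_n.
Local Notation mu := (@lebesgue_Cn R n).
Variable D : set Cn.
Hypothesis mD : measurable D.
Implicit Types f g : Cn -> C.

Lemma complex_ReD (a b : C) : complex.Re (a + b) = complex.Re a + complex.Re b.
Proof. by case: a b => ? ? []. Qed.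

Lemma complex_ImD (a b : C) : complex.Im (a + b) = complex.Im a + complex.Im b.
Proof. by case: a b => ? ? []. Qed.

Lemma complex_ReM (a b : C) :
  complex.Re (a * b) = complex.Re a * complex.Re b - complex.Im a * complex.Im b.
Proof. by case: a b => ? ? []. Qed.

Lemma complex_ImM (a b : C) :
  complex.Im (a * b) = complex.Re a * complex.Im b + complex.Im a * complex.Re b.
Proof. by case: a b => ? ? []. Qed.

Lemma complex_ReJ (a : C) : complex.Re a^* = complex.Re a.
Proof. by case: a. Qed.

Lemma complex_ImJ (a : C) : complex.Im a^* = - complex.Im a.
Proof. by case: a. Qed.

Definition Cmeasurable f : Prop :=
  measurable_fun D (fun z => complex.Re (f z)) /\
  measurable_fun D (fun z => complex.Im (f z)).

Lemma CmeasurableD f g : Cmeasurable f -> Cmeasurable g ->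
  Cmeasurable (fun z => f z + g z).
Proof.
move=> [f1 f2] [g1 g2]; split.
  by under eq_fun do rewrite complex_ReD; exact: measurable_funD.
by under eq_fun do rewrite complex_ImD; exact: measurable_funD.
Qed.

Lemma CmeasurableM f g : Cmeasurable f -> Cmeasurable g ->
  Cmeasurable (fun z => f z * g z).
Proof.
move=> [f1 f2] [g1 g2]; split.
  by under eq_fun do rewrite complex_ReM; apply: measurable_funB; exact: measurable_funM.
by under eq_fun do rewrite complex_ImM; apply: measurable_funD; exact: measurable_funM.
Qed.

Lemma Cmeasurable_conj f : Cmeasurable f -> Cmeasurable (fun z => (f z)^*).
Proof.
move=> [f1 f2]; split.
  by under eq_fun do rewrite complex_ReJ.
by under eq_fun do rewrite complex_ImJ; exact: measurable_funN.
Qed.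

Lemma Cmeasurable_cst (c : C) : Cmeasurable (fun=> c).
Proof. by split; exact: measurable_cst. Qed.

Lemma measurable_sqnormc f : Cmeasurable f -> measurable_fun D (fun z => sqnormc (f z)).
Proof.
by move=> [f1 f2]; apply: measurable_funD; exact: measurable_funX.
Qed.

Definition Cintegrable f : Prop :=
  mu.-integrable D (fun z => (complex.Re (f z))%:E) /\
  mu.-integrable D (fun z => (complex.Im (f z))%:E).

Lemma CintegrableZ (a : C) f : Cintegrable f -> Cintegrable (fun z => a * f z).
Proof.
move=> [f1 f2]; split.
  under eq_fun do rewrite complex_ReM EFinB !EFinM.
  by apply: integrableB => //; exact: integrableZl.
under eq_fun do rewrite complex_ImM EFinD !EFinM.
by apply: integrableD => //; exact: integrableZl.
Qed.

Lemma CintegralD f g : Cintegrable f -> Cintegrable g ->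
  Cintegral D (fun z => f z + g z) = Cintegral D f + Cintegral D g.
Proof.
move=> [f1 f2] [g1 g2]; rewrite /Cintegral.
under eq_Rintegral do rewrite complex_ReD.
under [in X in _ +i* X]eq_Rintegral do rewrite complex_ImD.
by rewrite !RintegralD.
Qed.

Lemma CintegralZ (a : C) f : Cintegrable f ->
  Cintegral D (fun z => a * f z) = a * Cintegral D f.
Proof.
case: a => x y [f1 f2]; rewrite /Cintegral.
have Z (c : R) (h : Cn -> R) : mu.-integrable D (fun z => (h z)%:E) ->
    mu.-integrable D (fun z => (c * h z)%:E).
  by move=> ih; under eq_fun do rewrite EFinM; exact: integrableZl.
under eq_Rintegral do rewrite complex_ReM.
under [in X in _ +i* X]eq_Rintegral do rewrite complex_ImM.
rewrite /= RintegralB ?RintegralD ?RintegralZl//; try exact: Z.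
Qed.

Lemma Cintegral_conj f : Cintegrable f ->
  Cintegral D (fun z => (f z)^*) = (Cintegral D f)^*.
Proof.
move=> [f1 f2]; rewrite /Cintegral /=; congr (_ +i* _).
  by apply: eq_Rintegral => z _; rewrite complex_ReJ.
rewrite -mulN1r -RintegralZl//.
by apply: eq_Rintegral => z _; rewrite complex_ImJ mulN1r.
Qed.

Lemma L2P f : L2 D f <-> Cmeasurable f /\ mu.-integrable D (fun z => (sqnormc (f z))%:E).
Proof.
have E z : complex.Re (`|f z| ^+ 2 : C) = sqnormc (f z) by rewrite -add_Re2_Im2.
have EI : (\int[mu]_(z in D) (complex.Re (`|f z| ^+ 2 : C))%:E =
    \int[mu]_(z in D) `|(sqnormc (f z))%:E|)%E.
  by apply: eq_integral => z _; rewrite E gee0_abs// lee_fin sqnormc_ge0.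
split=> [[f1 f2 foo]|[[f1 f2] /integrableP[_ foo]]].
  have mf : Cmeasurable f by [].
  split => //; apply/integrableP; split.
    by apply/measurable_EFinP; exact: measurable_sqnormc.
  by rewrite -EI.
by split => //; rewrite EI.
Qed.

(** The real and imaginary parts of f conj(g) are dominated by |f|^2 + |g|^2. *)
Lemma L2_mul_conj_integrable f g : L2 D f -> L2 D g -> Cintegrable (fun z => f z * (g z)^*).
Proof.
move=> /L2P[mf f2] /L2P[mg g2].
have [m1 m2] := CmeasurableM mf (Cmeasurable_conj mg).
have ifg := integrableD mD f2 g2.
have bound (h : Cn -> R) : measurable_fun D h ->
    (forall z, `|h z| <= sqnormc (f z) + sqnormc (g z)) ->
    mu.-integrable D (fun z => (h z)%:E).
  move=> mh hle; apply: le_integrable ifg => //; first exact/measurable_EFinP.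
  move=> z _ /=; rewrite lee_fin; exact: le_trans (hle z) (ler_norm _).
split; apply: bound => // z; rewrite /sqnormc ler_norml;
  case: (f z) (g z) => a b [c d] /=.
- have := sqr_ge0 (a - c); have := sqr_ge0 (a + c).
  have := sqr_ge0 (b - d); have := sqr_ge0 (b + d).
  rewrite !expr2 => *; apply/andP; split; nra.
- have := sqr_ge0 (a - d); have := sqr_ge0 (a + d).
  have := sqr_ge0 (b - c); have := sqr_ge0 (b + c).
  rewrite !expr2 => *; apply/andP; split; nra.
Qed.

Lemma L2_inner_ge0 f : 0 <= complex.Re (L2_inner D f f).
Proof.
rewrite /L2_inner /Cintegral /=; apply: Rintegral_ge0 => z _.
by rewrite mul_conjc /= sqnormc_ge0.
Qed.

Lemma L2_semi_inner : semi_inner (L2 D) (@L2_inner R n D).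
Proof.
split.
- apply/L2P; split; first exact: Cmeasurable_cst.
  rewrite (_ : (fun z => _) = cst 0%E); first exact: integrable0.
  by apply/funext => z; rewrite /sqnormc /= expr0n addr0.
- move=> a f g /L2P[mf f2] /L2P[mg g2]; apply/L2P; split.
    exact: (CmeasurableD (CmeasurableM (Cmeasurable_cst a) mf) mg).
  have mS : Cmeasurable (a *: f + g).
    exact: (CmeasurableD (CmeasurableM (Cmeasurable_cst a) mf) mg).
  have := integrableD mD (integrableZl mD (2 * sqnormc a) f2) (integrableZl mD 2 g2).
  apply: le_integrable => //; first by apply/measurable_EFinP; exact: measurable_sqnormc.
  move=> z _ /=; rewrite lee_fin ger0_norm ?sqnormc_ge0//.
  by rewrite (le_trans _ (ler_norm _))// (le_trans (sqnormcD_le _ _))// sqnormcM mulrA.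
- move=> a f g h Lf Lg Lh; rewrite /L2_inner.
  have ifh := L2_mul_conj_integrable Lf Lh; have igh := L2_mul_conj_integrable Lg Lh.
  rewrite -CintegralZ// -CintegralD//; last exact: CintegrableZ.
  by congr Cintegral; apply/funext => z; rewrite /= mulrDl mulrA.
- move=> f g Lf Lg; rewrite /L2_inner -Cintegral_conj; last exact: L2_mul_conj_integrable.
  by congr Cintegral; apply/funext => z; rewrite rmorphM /= conjcK mulrC.
- by move=> f _; exact: L2_inner_ge0.
Qed.

Lemma form_semi_inner : semi_inner [set g : 'I_n -> Cn -> C | forall j, L2 D (g j)]
  (@form_inner R n D).
Proof.
have L := L2_semi_inner.
split.
- by move=> j; exact: semi_inner0 L.
- by move=> a f g Lf Lg j; exact: (semi_innerP L).
- move=> a f g h Lf Lg Lh; rewrite /form_inner mulr_sumr -big_split; apply: eq_bigr => j _.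
  exact: (semi_inner_linear L).
- move=> f g Lf Lg; rewrite /form_inner rmorph_sum; apply: eq_bigr => j _.
  exact: (semi_inner_conj L).
- move=> f Lf; rewrite /form_inner.
  rewrite (_ : complex.Re _ = \sum_j complex.Re (L2_inner D (f j) (f j))).
    by rewrite sumr_ge0// => j _; exact: L2_inner_ge0.
  by elim/big_rec2 : _ => [//|j x y _ <-]; rewrite complex_ReD.
Qed.

End Cintegral_theory.

(** * Monomials on the unit ball *)

Lemma bernoulli_le {R : realFieldType} (x : R) k : 0 <= x -> x <= 1 ->
  1 - k%:R * x <= (1 - x) ^+ k.
Proof.
move=> x0 x1; elim: k => [|k IH]; first by rewrite mul0r subr0 expr0.
have x1' : 0 <= 1 - x by rewrite subr_ge0.
rewrite exprS; apply: le_trans (ler_wpM2l x1' IH).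
rewrite -natr1; have : 0 <= k%:R * x * x by rewrite !mulr_ge0.
by lra.
Qed.

Section ball.
Context {R : realType} {n : nat}.
Local Notation C := R[i].
Local Notation Cn := 'rV[C]_n.
Local Notation T := (measurableTypeR R * measurableTypeR R)%type.
Local Notation mu := (@lebesgue_Cn R n).
Local Notation B := (@unit_ball R n).

Lemma Cmeasurable_coord (D : set Cn) j : Cmeasurable D (fun z => z ord0 j).
Proof.
by split; apply: measurable_funTS;
  [apply: (measurableT_comp measurable_fst (measurable_Cn_coord j))|
   apply: (measurableT_comp measurable_snd (measurable_Cn_coord j))].
Qed.

Lemma measurable_sqnormv (D : set Cn) : measurable_fun D (@sqnormv R n).
Proof.
rewrite /sqnormv; apply: measurable_sum => j.
exact: (measurable_sqnormc (Cmeasurable_coord D j)).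
Qed.

Lemma measurable_sqnormv_lt (r : R) : measurable [set z : Cn | sqnormv z < r].
Proof.
have := @measurable_sqnormv setT measurableT `]-oo, r[%classic (measurable_itv _).
rewrite setTI; congr measurable.
Qed.

Lemma unit_ball_set : B = [set z : Cn | sqnormv z < 1].
Proof. by apply/predeqP => z; exact: unit_ballE. Qed.

Lemma measurable_unit_ball : measurable B.
Proof. by rewrite unit_ball_set; exact: measurable_sqnormv_lt. Qed.

Lemma sqnormc_coord_le (z : Cn) i j : i != j ->
  sqnormc (z ord0 i) + sqnormc (z ord0 j) <= sqnormv z.
Proof.
move=> ij; rewrite /sqnormv (bigD1 i)//= lerD2l (bigD1 j)/=; last by rewrite eq_sym.
by rewrite lerDl sumr_ge0// => k _; exact: sqnormc_ge0.
Qed.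

Lemma sqnormc_coord_le1 (z : Cn) i : B z -> sqnormc (z ord0 i) <= 1.
Proof.
move=> /unit_ballE z1; apply: le_trans (ltW z1).
by rewrite /sqnormv (bigD1 i)//= lerDl sumr_ge0// => k _; exact: sqnormc_ge0.
Qed.

Lemma lebesgue_unit_ball_lty : (mu B < +oo)%E.
Proof.
pose Q (_ : 'I_n) : set T := `[(-1 : R), 1]%classic `*` `[(-1 : R), 1]%classic.
have mQ i : measurable (Q i) by apply: measurableX; exact: measurable_itv.
apply: (@le_lt_trans _ _ (mu [set z | forall i, Q i (Cn_coord i z)])).
  apply: le_measure; rewrite ?inE; [exact: measurable_unit_ball|exact: measurable_Cn_box|].
  move=> z Bz i; have := sqnormc_coord_le1 i Bz; rewrite /sqnormc => z1.
  have sq1 (x : R) : x ^+ 2 <= 1 -> -1 <= x <= 1.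
    by rewrite -ler_norml => x1; rewrite -(@ler_pXn2r _ 2)// ?nnegrE// expr1n real_normK ?num_real.
  rewrite /Q /= !in_itv /=; split; apply: sq1; apply: le_trans z1;
  by rewrite ?lerDl ?lerDr sqr_ge0.
rewrite lebesgue_Cn_box// (eq_bigr (fun=> 4%:E)) => [|i _]; last first.
  by rewrite lebesgue_plane_rectangle//; congr (_%:E); ring.
by rewrite prodEFin ltry.
Qed.

Lemma integrable_bounded_ball (f : Cn -> R) M : measurable_fun B f ->
  (forall z, B z -> `|f z| <= M) -> mu.-integrable B (fun z => (f z)%:E).
Proof.
move=> mf fM; apply: measurable_bounded_integrable => //.
- exact: measurable_unit_ball.
- exact: lebesgue_unit_ball_lty.
exists M; split; first exact: num_real.
by move=> x Mx z Bz; exact: le_trans (fM z Bz) (ltW Mx).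
Qed.

Variable i : 'I_n.

(** The squared L^2 norm of z_i^k, written A_k in the overview. *)
Definition ball_moment (k : nat) : R := \int[mu]_(z in B) (sqnormc (z ord0 i) ^+ k).

Lemma measurable_sqnormcX D k : measurable_fun D (fun z : Cn => sqnormc (z ord0 i) ^+ k).
Proof. apply: measurable_funX; exact: (measurable_sqnormc (Cmeasurable_coord D i)). Qed.

Lemma sqnormcX_le1 k (z : Cn) : B z -> sqnormc (z ord0 i) ^+ k <= 1.
Proof. by move=> Bz; rewrite exprn_ile1// ?sqnormc_ge0// sqnormc_coord_le1. Qed.

Lemma integrable_moment k : mu.-integrable B (fun z => (sqnormc (z ord0 i) ^+ k)%:E).
Proof.
apply: (@integrable_bounded_ball _ 1); first exact: measurable_sqnormcX.
by move=> z Bz; rewrite ger0_norm ?exprn_ge0 ?sqnormc_ge0// sqnormcX_le1.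
Qed.

Lemma ball_momentE k :
  (\int[mu]_(z in B) (sqnormc (z ord0 i) ^+ k)%:E = (ball_moment k)%:E)%E.
Proof.
rewrite /ball_moment /Rintegral fineK//.
by apply: integrable_fin_num; [exact: measurable_unit_ball|exact: integrable_moment].
Qed.

Lemma ball_momentS_le k : ball_moment k.+1 <= ball_moment k.
Proof.
apply: le_Rintegral; [exact: measurable_unit_ball|exact: integrable_moment..|].
move=> z Bz; rewrite exprS ler_piMl ?exprn_ge0 ?sqnormc_ge0//.
exact: sqnormc_coord_le1.
Qed.

(** The substitution z = sqrt(r) w multiplies the integrand by r^k and the volume by r^n, and it
    carries the unit ball onto the set |z|^2 < r. *)
Lemma ball_moment_scale k (r : R) : 0 < r -> r <= 1 ->
  (\int[mu]_(z in [set z : Cn | (sqnormv z < r)%R]) (sqnormc (z ord0 i) ^+ k)%:E =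
   (r ^+ (k + n) * ball_moment k)%:E)%E.
Proof.
move=> r0 r1; pose c : C := (Num.sqrt r)%:C.
have cr : sqnormc c = r by rewrite sqnormc_real sqr_sqrtr// ltW.
have c0 : c != 0.
  by apply: contra_eq_neq cr => ->; rewrite /sqnormc /= expr0n addr0 lt_eqF.
have scv z : sqnormv (c *: z) = r * sqnormv z.
  by rewrite /sqnormv mulr_sumr; apply: eq_bigr => j _; rewrite mxE sqnormcM cr.
pose D := [set z : Cn | sqnormv z < r].
have mD : measurable D by exact: measurable_sqnormv_lt.
pose f (z : Cn) := (sqnormc (z ord0 i) ^+ k)%:E.
have mf : measurable_fun D f by apply/measurable_EFinP; exact: measurable_sqnormcX.
have mfD : measurable_fun setT (f \_ D) by exact/(measurable_restrictT _ mD).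
have f0 z : (0 <= (f \_ D) z)%E.
  by rewrite /patch; case: ifPn => // _; rewrite lee_fin exprn_ge0 ?sqnormc_ge0.
rewrite integral_mkcond (ge0_integral_Cn_scale c0 mfD f0) cr exprD mulrAC EFinM muleC.
congr (_ * _)%E.
rewrite EFinM -ball_momentE -ge0_integralZl//; first last.
- by rewrite lee_fin exprn_ge0 ?ltW.
- by move=> z _; rewrite lee_fin exprn_ge0 ?sqnormc_ge0.
- by apply/measurable_EFinP; exact: measurable_sqnormcX.
- exact: measurable_unit_ball.
rewrite [RHS]integral_mkcond; apply: eq_integral => z _.
rewrite /patch (_ : (c *: z \in D) = (z \in B)); last first.
  apply/asbool_equiv_eq; rewrite unit_ball_set /D /= scv.
  by rewrite -[X in _ < X]mulr1 ltr_pM2l.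
by case: ifPn => // _; rewrite /f mxE sqnormcM cr exprMn EFinM.
Qed.

Lemma ball_moment_ge k (s : R) : 0 < s -> n%:R * s < 1 -> 8 * k%:R * s <= 1 -> 4 * s <= 1 ->
  2^-1 * s ^+ (2 * n) <= ball_moment k.
Proof.
move=> s0 ns ks s1.
(* A box close to the i-th unit vector: Re z_i lies in [1 - 2s, 1 - s], the other 2n - 1 real
   coordinates in [0, s]. On it |z|^2 <= 1 - 2s + 2n s^2 < 1 and |z_i|^2 >= 1 - 4s, so Bernoulli's
   inequality gives |z_i|^(2k) >= 1 - 4ks >= 1/2. *)
pose Q (j : 'I_n) : set T :=
  (if j == i then `[1 - 2 * s, 1 - s]%classic else `[0, s]%classic) `*` `[0, s]%classic.
have mQ j : measurable (Q j).
  by apply: measurableX; [case: ifP => _|]; exact: measurable_itv.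
have muQ j : lebesgue_plane R (Q j) = (s ^+ 2)%:E.
  rewrite /Q; case: ifP => _; (rewrite lebesgue_plane_rectangle; [|lra|lra]);
  by congr (_%:E); ring.
pose E := [set z : Cn | forall j, Q j (Cn_coord j z)].
have mE : measurable E by exact: measurable_Cn_box.
have muE : mu E = (s ^+ (2 * n))%:E.
  rewrite lebesgue_Cn_box// (eq_bigr (fun=> (s ^+ 2)%:E)) => [|j _]; last exact: muQ.
  by rewrite prodEFin prodr_const card_ord exprM.
have EB : E `<=` B.
  move=> z Ez; apply/unit_ballE.
  have sq (x : R) : 0 <= x -> x <= s -> x ^+ 2 <= s ^+ 2.
    by move=> x0 xs; rewrite ler_pXn2r ?nnegrE// ltW.
  have le (j : 'I_n) : sqnormc (z ord0 j) <= 2 * s ^+ 2 + (if j == i then 1 - 2 * s else 0).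
    have := Ez j; rewrite /Q /Cn_coord /sqnormc /=; case: ifP => _ [/=];
      rewrite !in_itv /= => /andP[a b] /andP[c d].
      have := sq _ c d; have : (complex.Re (z ord0 j)) ^+ 2 <= (1 - s) ^+ 2.
        by rewrite ler_pXn2r ?nnegrE//; lra.
      by rewrite !expr2; nra.
    by have := sq _ a b; have := sq _ c d; lra.
  apply: (@le_lt_trans _ _ (\sum_(j < n) (2 * s ^+ 2 + (if j == i then 1 - 2 * s else 0)))).
    by apply: ler_sum => j _; exact: le.
  rewrite big_split /= -big_mkcond /= big_pred1_eq sumr_const card_ord -mulr_natl.
  have : n%:R * s * s < s by rewrite gtr_pMl.
  by rewrite expr2; nra.
have zk z : E z -> 2^-1 <= sqnormc (z ord0 i) ^+ k.
  move=> /(_ i); rewrite /Q eqxx /Cn_coord /= !in_itv /= => -[/andP[a b] _].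
  have h1 : (1 - 4 * s) <= sqnormc (z ord0 i).
    rewrite /sqnormc; have : (1 - 2 * s) ^+ 2 <= complex.Re (z ord0 i) ^+ 2.
      by rewrite ler_pXn2r ?nnegrE//; lra.
    by have := sqr_ge0 (complex.Im (z ord0 i)); rewrite !expr2; nra.
  apply: (@le_trans _ _ ((1 - 4 * s) ^+ k)); last first.
    by apply: lerXn2r; rewrite ?nnegrE ?sqnormc_ge0//; lra.
  apply: le_trans (bernoulli_le _ _ _); lra.
rewrite -lee_fin -ball_momentE.
apply: (@le_trans _ _ (\int[mu]_(z in E) (2^-1 : R)%:E)%E).
  have -> : (\int[mu]_(z in E) (2^-1 : R)%:E = (2^-1 : R)%:E * mu E)%E.
    by rewrite integral_cst.
  by rewrite muE -EFinM.
apply: (@le_trans _ _ (\int[mu]_(z in E) (sqnormc (z ord0 i) ^+ k)%:E)%E).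
  apply: ge0_le_integral => //.
  - by apply/measurable_EFinP; exact: measurable_sqnormcX.
apply: (@ge0_subset_integral _ _ _ mu _ _ mE measurable_unit_ball) => //.
- by apply/measurable_EFinP; exact: measurable_sqnormcX.
- by move=> z _; rewrite lee_fin exprn_ge0 ?sqnormc_ge0.
Qed.

End ball.

(** The conjugation inside [L2_inner] is [Num.conj], that of the bumps is [conjc]; the two are
    convertible but do not match syntactically. *)
Lemma conj_conjc {R : realType} (a : R[i]) : Num.conj (conjc a) = a.
Proof. exact: conjcK. Qed.

(** * Forms with one nonzero coefficient, and their pairings with the bumps *)

Section ball_forms.
Context {R : realType} {n : nat}.
Local Notation C := R[i].
Local Notation Cn := 'rV[C]_n.
Local Notation mu := (@lebesgue_Cn R n).
Local Notation B := (@unit_ball R n).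
Variables i j : 'I_n.
Hypothesis ij : j != i.

Lemma L2_bounded (f : Cn -> C) M : Cmeasurable B f ->
  (forall z, B z -> sqnormc (f z) <= M) -> L2 B f.
Proof.
move=> mf fM; apply/L2P; split=> //; apply: (@integrable_bounded_ball _ _ _ M).
  exact: measurable_sqnormc.
by move=> z Bz; rewrite ger0_norm ?sqnormc_ge0// fM.
Qed.

Lemma Cmeasurable_coordX (D : set Cn) k : Cmeasurable D (fun z => z ord0 i ^+ k).
Proof.
elim: k => [|k IH]; first exact: Cmeasurable_cst.
under eq_fun do rewrite exprS.
exact: (CmeasurableM (Cmeasurable_coord D i) IH).
Qed.

Lemma bergman_coordX k : bergman_space B (fun z => z ord0 i ^+ k).
Proof.
split=> [z _|].
  have dc := @differentiable_coord C 1 n z ord0 i.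
  elim: k => [|k IH]; first exact: differentiable_cst.
  by under eq_fun do rewrite exprS; exact: differentiableM.
apply: (@L2_bounded _ 1); first exact: Cmeasurable_coordX.
by move=> z Bz; rewrite sqnormcX sqnormcX_le1.
Qed.

Definition single_form (f : Cn -> C) : 'I_n -> Cn -> C :=
  fun l => if l == j then f else fun=> 0.

Lemma single_form_bergman f : bergman_space B f -> bergman_forms B (single_form f).
Proof.
move=> Bf l; rewrite /single_form; case: ifP => // _; split=> [z _|].
  exact: differentiable_cst.
by apply: (@L2_bounded _ 0); [exact: Cmeasurable_cst|rewrite sqnormc_real expr0n].
Qed.

Lemma form_inner_single (g : 'I_n -> Cn -> C) f :
  form_inner B g (single_form f) = L2_inner B (g j) f.
Proof.
rewrite /form_inner (bigD1 j)//= big1 ?addr0 => [|l lj].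
  by rewrite /single_form eqxx.
rewrite /single_form (negbTE lj) /L2_inner /Cintegral.
have -> : (fun z => complex.Re (g l z * (0 : C)^*)) = cst 0.
  by apply/funext => z; rewrite rmorph0 mulr0.
have -> : (fun z => complex.Im (g l z * (0 : C)^*)) = cst 0.
  by apply/funext => z; rewrite rmorph0 mulr0.
by rewrite Rintegral_cst ?mul0r//; exact: measurable_unit_ball.
Qed.

Lemma Cmeasurable_real (D : set Cn) (f : Cn -> R) :
  measurable_fun D f -> Cmeasurable D (fun z => (f z)%:C).
Proof. by move=> mf; split => //=; exact: measurable_cst. Qed.

Lemma measurable_flat m K (D : set Cn) :
  measurable_fun D (fun z : Cn => flat m (K * (1 - sqnormv z) - 1)).
Proof.
apply: measurable_funTS; apply: measurableT_comp.
  by apply: continuous_measurable_fun; exact: continuous_flat.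
apply: measurable_funB => //; apply: measurable_funM => //.
by apply: measurable_funB => //; exact: measurable_sqnormv.
Qed.

Lemma L2_bump_conj k K : L2 B (fun z => (radial_bump i k K z)^*).
Proof.
apply: (@L2_bounded _ 1).
  apply: Cmeasurable_conj; apply: CmeasurableM.
    rewrite (_ : (fun z => _) = fun z : Cn => (z ord0 i ^+ k)^*); last first.
      by apply/funext => z; rewrite rmorphXn.
    by apply: Cmeasurable_conj; exact: Cmeasurable_coordX.
  by apply: Cmeasurable_real; exact: measurable_flat.
move=> z Bz; rewrite sqnormcJ sqnormcM sqnormcX sqnormcJ sqnormc_real.
rewrite mulr_ile1 ?exprn_ge0 ?sqnormc_ge0 ?flat_ge0 ?sqnormcX_le1//.
by rewrite exprn_ile1 ?flat_ge0 ?flat0_le1.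
Qed.

(** The psi_k of the overview. It is conjugated because [L2_inner] conjugates its second argument,
    so that pairing u with it integrates u times [dbar_deriv j] of the bump. *)
Definition dbar_bump_conj k K (z : Cn) : C := (dbar_deriv j (radial_bump i k K) z)^*.

Lemma dbar_bump_conjE k K z : dbar_bump_conj k K z =
  z ord0 i ^+ k * (z ord0 j)^* * (- K * flat 2 (K * (1 - sqnormv z) - 1))%:C.
Proof.
rewrite /dbar_bump_conj dbar_deriv_bump//; set f := flat 2 _.
have aux (a b : C) (r s : R) :
    (a * r%:C * (- s%:C * b))^* = a^* * b^* * (- s * r)%:C.
  by case: a b => a1 a2 [b1 b2]; apply/eqP; rewrite eq_complex /=; apply/andP;
    split; apply/eqP; ring.
rewrite aux; congr (_ * _ * _); elim: k => [|k IH]; first by rewrite !expr0 rmorph1.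
by rewrite !exprS rmorphM /= IH conjCK.
Qed.

Lemma Cmeasurable_dbar_bump_conj (D : set Cn) k K : Cmeasurable D (dbar_bump_conj k K).
Proof.
rewrite (_ : dbar_bump_conj k K = fun z => z ord0 i ^+ k * (z ord0 j)^* *
  (- K * flat 2 (K * (1 - sqnormv z) - 1))%:C); last by apply/funext => z; exact: dbar_bump_conjE.
apply: CmeasurableM.
  exact: (CmeasurableM (Cmeasurable_coordX D k) (Cmeasurable_conj (Cmeasurable_coord D j))).
by apply: Cmeasurable_real; apply: measurable_funM => //; exact: measurable_flat.
Qed.

(** The 4 is the square of the bound 2! on [flat 2], and K^2 comes from the chain rule. The right
    side is written so that it integrates to a difference of consecutive moments. *)
Lemma sqnormc_dbar_bump_le k K z : B z ->
  sqnormc (dbar_bump_conj k K z) <=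
  4 * K ^+ 2 * (sqnormc (z ord0 i) ^+ k - sqnormc (z ord0 i) ^+ k.+1).
Proof.
move=> /unit_ballE Bz; rewrite dbar_bump_conjE !sqnormcM sqnormcX sqnormcJ sqnormc_real.
set a := sqnormc (z ord0 i); set b := sqnormc (z ord0 j).
have a0 : 0 <= a by exact: sqnormc_ge0.
have b0 : 0 <= b by exact: sqnormc_ge0.
have ba : b <= 1 - a.
  by have := sqnormc_coord_le z ij; rewrite -/a -/b; move: Bz; lra.
set f := flat 2 _.
have f0 : 0 <= f by exact: flat_ge0.
have f2 : f ^+ 2 <= 4.
  have -> : 4 = 2 ^+ 2 :> R by rewrite -natrX.
  by rewrite ler_pXn2r ?nnegrE//; exact: flat_le_fact.
have -> : a ^+ k * b * (- K * f) ^+ 2 = (K ^+ 2 * a ^+ k) * (b * f ^+ 2) by ring.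
have -> : 4 * K ^+ 2 * (a ^+ k - a ^+ k.+1) = (K ^+ 2 * a ^+ k) * ((1 - a) * 4).
  by rewrite [a ^+ k.+1]exprS; ring.
apply: ler_wpM2l; first by rewrite mulr_ge0 ?sqr_ge0 ?exprn_ge0.
by apply: ler_pM => //; exact: sqr_ge0.
Qed.

Lemma L2_dbar_bump_conj k K : L2 B (dbar_bump_conj k K).
Proof.
apply: (@L2_bounded _ (4 * K ^+ 2)); first exact: Cmeasurable_dbar_bump_conj.
move=> z Bz; apply: le_trans (sqnormc_dbar_bump_le k K Bz) _.
apply: ler_piMr; first by rewrite mulr_ge0 ?sqr_ge0.
rewrite lerBlDr (le_trans (sqnormcX_le1 i k Bz))// lerDl.
by rewrite exprn_ge0 ?sqnormc_ge0.
Qed.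

Lemma L2_inner_dbar_bump k K (S : ('I_n -> Cn -> C) -> Cn -> C) g :
  canonical_solution_operator B S -> bergman_forms B g -> 0 < K ->
  L2_inner B (S g) (dbar_bump_conj k K) =
  - form_inner B g (single_form (fun z => (radial_bump i k K z)^*)).
Proof.
move=> hS Bg K0; have [_ /(_ _ (test_function_bump i k K0) j) h _] := hS g Bg.
rewrite form_inner_single /L2_inner.
under [in LHS]eq_fun do rewrite /dbar_bump_conj conj_conjc.
by under [in RHS]eq_fun do rewrite conj_conjc.
Qed.

Lemma form_inner_coordX k :
  form_inner B (single_form (fun z => z ord0 i ^+ k)) (single_form (fun z => z ord0 i ^+ k)) =
  (ball_moment i k)%:C.
Proof.
rewrite form_inner_single /single_form eqxx /L2_inner /Cintegral.
under eq_Rintegral do rewrite mul_conjc sqnormcX /=.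
under [in X in _ +i* X]eq_Rintegral do rewrite mul_conjc /=.
by rewrite Rintegral_cst ?mul0r//; exact: measurable_unit_ball.
Qed.

(** The integrand is nonnegative and may be restricted to |z|^2 < 1 - 2/K, where the cutoff is at
    least exp(-1); [ball_moment_scale] evaluates what remains. The condition K > 2 makes this radius
    positive. *)
Lemma form_inner_coordX_bump k K : 2 < K ->
  exists2 I : R, form_inner B (single_form (fun z => z ord0 i ^+ k))
      (single_form (fun z => (radial_bump i k K z)^*)) = I%:C &
    expR (-1) * ((1 - 2 / K) ^+ (k + n) * ball_moment i k) <= I.
Proof.
move=> K2; have K0 : 0 < K by lra.
pose F (z : Cn) := sqnormc (z ord0 i) ^+ k * flat 0 (K * (1 - sqnormv z) - 1).
have FE (z : Cn) : z ord0 i ^+ k * Num.conj ((radial_bump i k K z)^*) = (F z)%:C.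
  rewrite conj_conjc /radial_bump mulrA -rmorphXn mul_conjc sqnormcX /F.
  by rewrite -rmorphM.
exists (\int[mu]_(z in B) F z).
  rewrite form_inner_single /single_form eqxx /L2_inner /Cintegral.
  under eq_Rintegral do rewrite FE /=.
  under [in X in _ +i* X]eq_Rintegral do rewrite FE /=.
  by rewrite [in X in _ +i* X]Rintegral_cst ?mul0r//; exact: measurable_unit_ball.
have F0 z : 0 <= F z by rewrite mulr_ge0 ?flat_ge0 ?exprn_ge0 ?sqnormc_ge0.
have mF D : measurable_fun D F.
  by apply: measurable_funM; [exact: measurable_sqnormcX|exact: measurable_flat].
have iF : mu.-integrable B (fun z => (F z)%:E).
  apply: (@integrable_bounded_ball _ _ _ 1) => // z Bz; rewrite ger0_norm//.
  by rewrite mulr_ile1 ?exprn_ge0 ?sqnormc_ge0 ?flat_ge0 ?sqnormcX_le1 ?flat0_le1.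
have mB := @measurable_unit_ball R n.
rewrite -lee_fin /Rintegral fineK; last exact: integrable_fin_num.
have r0 : 0 < 1 - 2 / K by rewrite subr_gt0 ltr_pdivrMr// mul1r.
have r1 : 1 - 2 / K < 1 by rewrite ltrBlDr ltrDl divr_gt0.
rewrite EFinM -(ball_moment_scale i k r0 (ltW r1)).
set D := [set z : Cn | _]; have mD : measurable D by exact: measurable_sqnormv_lt.
have DB : D `<=` B by move=> z Dz; apply/unit_ballE; exact: lt_trans r1.
rewrite -ge0_integralZl//; last 2 first.
- by apply/measurable_EFinP; exact: measurable_sqnormcX.
- by move=> z _; rewrite lee_fin exprn_ge0 ?sqnormc_ge0.
apply: (@le_trans _ _ (\int[mu]_(z in D) (F z)%:E)%E); last first.
  apply: (@ge0_subset_integral _ _ _ mu _ _ mD mB) => //.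
  - by apply/measurable_EFinP.
  - by move=> z _; rewrite lee_fin.
apply: ge0_le_integral => //.
- by move=> z _; rewrite -EFinM lee_fin mulr_ge0 ?expR_ge0 ?exprn_ge0 ?sqnormc_ge0.
- apply/measurable_EFinP; apply: measurable_funM => //; exact: measurable_sqnormcX.
- by apply/measurable_EFinP.
- move=> z Dz; rewrite -EFinM lee_fin mulrC ler_wpM2l ?exprn_ge0 ?sqnormc_ge0//.
  apply: flat0_ge; move: Dz; rewrite /D /= => Dz.
  have : K * (2 / K) < K * (1 - sqnormv z) by rewrite ltr_pM2l//; lra.
  by rewrite mulrCA divff ?gt_eqF// mulr1; lra.
Qed.

Lemma L2_norm_dbar_bump_le k K :
  complex.Re (L2_inner B (dbar_bump_conj k K) (dbar_bump_conj k K)) <=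
  4 * K ^+ 2 * (ball_moment i k - ball_moment i k.+1).
Proof.
have mB := @measurable_unit_ball R n.
have -> : complex.Re (L2_inner B (dbar_bump_conj k K) (dbar_bump_conj k K)) =
    \int[mu]_(z in B) sqnormc (dbar_bump_conj k K z).
  by apply: eq_Rintegral => z _; rewrite mul_conjc.
have im := integrable_moment i.
have idiff : mu.-integrable B (fun z => (sqnormc (z ord0 i) ^+ k - sqnormc (z ord0 i) ^+ k.+1)%:E).
  by under eq_fun do rewrite EFinB; exact: integrableB.
have -> : 4 * K ^+ 2 * (ball_moment i k - ball_moment i k.+1) =
    \int[mu]_(z in B) (4 * K ^+ 2 * (sqnormc (z ord0 i) ^+ k - sqnormc (z ord0 i) ^+ k.+1)).
  by rewrite RintegralZl// RintegralB//; exact: im.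
apply: le_Rintegral => //.
- by have /L2P[] := L2_dbar_bump_conj k K.
- exact: (integrableZl mB (4 * K ^+ 2) idiff).
- by move=> z Bz; exact: sqnormc_dbar_bump_le.
Qed.

End ball_forms.

(** * Orthogonality of the psi_k by rotation *)

Section orthogonality.
Context {R : realType} {n : nat}.
Local Notation C := R[i].
Local Notation Cn := 'rV[C]_n.
Local Notation mu := (@lebesgue_Cn R n).
Local Notation B := (@unit_ball R n).
Variables i j : 'I_n.
Hypothesis ij : j != i.

(** Any m-th root of -1 has modulus 1. Rotating by it multiplies an integrand of weight m by -1,
    which is enough to make its integral vanish. *)
Lemma unimodular_rootN1 m : (0 < m)%N -> exists2 c : C, sqnormc c = 1 & c ^+ m = -1.
Proof.
move=> m0; have cm := rootCK m0 (-1 : C); exists (m.-root (-1 : C)) => //.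
have : sqnormc (m.-root (-1 : C)) ^+ m = 1.
  by rewrite -sqnormcX cm sqnormcN /sqnormc /= expr1n expr0n addr0.
by move/eqP; rewrite pexpr_eq1 ?sqnormc_ge0// => /eqP.
Qed.

Lemma dbar_bump_conj_scale k K (c : C) (z : Cn) : sqnormc c = 1 ->
  dbar_bump_conj i j k K (c *: z) = c ^+ k * c^* * dbar_bump_conj i j k K z.
Proof.
move=> c1; rewrite !dbar_bump_conjE//.
have -> : sqnormv (c *: z) = sqnormv z.
  by apply: eq_bigr => l _; rewrite mxE sqnormcM c1 mul1r.
rewrite !mxE exprMn rmorphM /=; ring.
Qed.

(** The rotation preserves the integral and changes the sign of the integrand, so the integral
    equals its own negative. *)
Lemma L2_inner_rotate_eq0 (c : C) (P Q : Cn -> C) :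
  sqnormc c = 1 -> L2 B P -> L2 B Q ->
  (forall z, P (c *: z) * (Q (c *: z))^* = - (P z * (Q z)^*)) ->
  L2_inner B P Q = 0.
Proof.
move=> c1 LP LQ GN.
have [i1 i2] := L2_mul_conj_integrable (@measurable_unit_ball R n) LP LQ.
have zero (h : Cn -> R) : mu.-integrable B (fun z => (h z)%:E) ->
    (forall z, h (c *: z) = - h z) -> \int[mu]_(z in B) h z = 0.
  move=> ih hN; have mB := @measurable_unit_ball R n.
  have cB z : B (c *: z) <-> B z.
    rewrite !unit_ballE (_ : sqnormv (c *: z) = sqnormv z)//.
    by apply: eq_bigr => p _; rewrite mxE sqnormcM c1 mul1r.
  have := integral_Cn_rotate c1 mB (measurable_int _ ih) cB.
  move=> /(congr1 fine); rewrite -!/(Rintegral _ _ _).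
  under eq_Rintegral do rewrite hN -mulN1r.
  rewrite RintegralZl// mulN1r => /eqP; rewrite eq_sym -subr_eq0 opprK -mulr2n.
  by rewrite mulrn_eq0 /= => /eqP.
have ReN (a : C) : complex.Re (- a) = - complex.Re a by case: a.
have ImN (a : C) : complex.Im (- a) = - complex.Im a by case: a.
have E1 : \int[mu]_(z in B) complex.Re (P z * (Q z)^*) = 0.
  by apply: (zero _ i1) => z; rewrite GN ReN.
have E2 : \int[mu]_(z in B) complex.Im (P z * (Q z)^*) = 0.
  by apply: (zero _ i2) => z; rewrite GN ImN.
by rewrite /L2_inner /Cintegral E1 E2.
Qed.

(** The cutoffs are radial, hence invariant under rotation, and only the degrees k and l matter;
    this leaves K free to depend on k. *)
Lemma dbar_bump_conj_orthogonal k l K L : k != l ->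
  L2_inner B (dbar_bump_conj i j k K) (dbar_bump_conj i j l L) = 0.
Proof.
move=> kl.
(* The factors conj(c) and c cancel, leaving c^k conj(c)^l, which is c^m or conj(c)^m with m = |k -
   l|. *)
have [c c1 cE] : exists2 c : C, sqnormc c = 1 &
    (c ^+ k * c^*) * (c ^+ l * c^*)^* = -1.
  have red (c : C) : sqnormc c = 1 ->
      (c ^+ k * c^*) * (c ^+ l * c^*)^* = c ^+ k * (c^*) ^+ l.
    move=> c1; have cc : c * c^* = 1 by rewrite mul_conjc c1.
    rewrite rmorphM rmorphXn /= conjCK.
    by rewrite (_ : _ * _ = c ^+ k * c^* ^+ l * (c * c^*)); [rewrite cc mulr1|ring].
  have [m m0 [kE|lE]] : exists2 m, (0 < m)%N & k = (l + m)%N \/ l = (k + m)%N.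
  - move: kl; rewrite neq_ltn => /orP[kl|lk].
      by exists (l - k)%N; rewrite ?subn_gt0//; right; rewrite subnKC// ltnW.
    by exists (k - l)%N; rewrite ?subn_gt0//; left; rewrite subnKC// ltnW.
  - have [c c1 cm] := unimodular_rootN1 m0; exists c => //.
    have cc : c * c^* = 1 by rewrite mul_conjc c1.
    by rewrite red// kE exprD cm mulrN1 mulNr -exprMn cc expr1n.
  - have [c c1 cm] := unimodular_rootN1 m0; exists c => //.
    have cc : c * c^* = 1 by rewrite mul_conjc c1.
    by rewrite red// lE exprD mulrA -exprMn cc expr1n mul1r -rmorphXn cm rmorphN rmorph1.
have GN z : dbar_bump_conj i j k K (c *: z) * (dbar_bump_conj i j l L (c *: z))^* =
    - (dbar_bump_conj i j k K z * (dbar_bump_conj i j l L z)^*).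
  rewrite !dbar_bump_conj_scale// rmorphM mulrACA.
  by have := cE; rewrite /= => ->; rewrite mulN1r.
exact: (L2_inner_rotate_eq0 c1 (L2_dbar_bump_conj ij k K) (L2_dbar_bump_conj ij l L) GN).
Qed.

End orthogonality.

(* The partial sums of x are O(ln N), and 1 / (m^2 x) >= 2 s / m - s^2 x for
   every s, so that a small s gives divergence.  The term y k below only serves
   to make x positive. *)
Lemma moment_series_diverges {R : realType} (A : nat -> R) (c : R) (D n : nat) :
  0 < c -> (0 < n)%N -> (forall k, c / k.+1%:R ^+ D <= A k) -> (forall k, A k.+1 <= A k) ->
  exists x : nat -> R, [/\ forall k, 0 < x k, forall k, A k - A k.+1 <= A k * x k &
    forall M, exists N, M < \sum_(k < N) ((k + n)%:R ^+ 2 * x k)^-1].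
Proof.
move=> c0 n0 Ac Adec.
have A0 k : 0 < A k by apply: lt_le_trans (Ac k); rewrite divr_gt0 ?exprn_gt0.
pose y k : R := ln k.+2%:R - ln k.+1%:R.
have y0 k : 0 < y k by rewrite subr_gt0 ltr_ln ?posrE// ltr_nat.
pose x k := ln (A k) - ln (A k.+1) + y k.
exists x; split.
- by move=> k; rewrite /x ltr_wpDl// subr_ge0 ler_ln ?posrE.
- move=> k; apply: (@le_trans _ _ (A k * (ln (A k) - ln (A k.+1)))).
    have -> : A k - A k.+1 = A k * (1 - A k.+1 / A k).
      by field; rewrite gt_eqF.
    rewrite ler_pM2l//.
    have t0 : 0 < A k.+1 / A k by rewrite divr_gt0.
    have := @le_ln1Dx R (A k.+1 / A k - 1); rewrite (addrC 1) subrK ln_div ?posrE//.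
    by move=> /(_ _) h; have := h ltac:(lra); lra.
  by rewrite ler_pM2l// lerDl ltW.
move=> M.
have sumx N : \sum_(k < N) x k = ln (A 0%N) - ln (A N) + ln N.+1%:R.
  elim: N => [|N IH]; first by rewrite big_ord0 subrr ln1 addr0.
  by rewrite big_ord_recr /= IH /x /y; ring.
have sumy N : \sum_(k < N) y k = ln N.+1%:R.
  elim: N => [|N IH]; first by rewrite big_ord0 ln1.
  by rewrite big_ord_recr /= IH /y; ring.
(* The sum of the x k grows at most like (D + 1) ln N, with D from the decay of A and 1 from y. For
   this s the gain 2 s / n = 2 s^2 (D + 1) is twice the loss s^2 (D + 1), so a positive multiple of
   ln N survives. *)
pose s : R := (n%:R * D.+1%:R)^-1.
have nR : 0 < n%:R :> R by rewrite ltr0n.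
have s0 : 0 < s by rewrite invr_gt0 mulr_gt0.
(* Here 1 / (k + n) is replaced by the smaller [y k / n], whose sum telescopes: y k <= 1 / (k + 1)
   and k + n <= n (k + 1). *)
have term k : 2 * s / n%:R * y k - s ^+ 2 * x k <= ((k + n)%:R ^+ 2 * x k)^-1.
  have kn0 : 0 < (k + n)%:R :> R by rewrite ltr0n addn_gt0 n0 orbT.
  have x0 : 0 < x k by rewrite /x ltr_wpDl// subr_ge0 ler_ln ?posrE.
  apply: (@le_trans _ _ (2 * s / (k + n)%:R - s ^+ 2 * x k)).
    rewrite lerD2r -mulrA ler_pM2l ?mulr_gt0//.
    have yk : y k <= k.+1%:R^-1.
      rewrite /y -ln_div ?posrE// (_ : _ / _ = 1 + k.+1%:R^-1); last first.
        by rewrite -[k.+2%:R]natr1 mulrDl divff ?pnatr_eq0// mul1r.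
      by rewrite le_ln1Dx// (@lt_trans _ _ 0) ?ltrN10 ?invr_gt0.
    have knle : (k + n)%:R <= n%:R * k.+1%:R :> R.
      rewrite -natrM ler_nat mulnS addnC leq_add2l.
      by rewrite -{1}[k]mul1n leq_mul2r n0 orbT.
    rewrite mulrC ler_pdivrMr// mulrC ler_pdivlMr//.
    apply: le_trans (ler_wpM2l (ltW (y0 k)) knle) _.
    rewrite mulrCA ger_pMr//.
    by rewrite -ler_pdivlMr// div1r.
  rewrite -subr_ge0.
  have -> : ((k + n)%:R ^+ 2 * x k)^-1 - (2 * s / (k + n)%:R - s ^+ 2 * x k) =
      x k * (((k + n)%:R * x k)^-1 - s) ^+ 2.
    by move: (x k) x0 (_%:R) kn0 => X X0 m m0; field; rewrite !gt_eqF.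
  by rewrite mulr_ge0 ?sqr_ge0 ?ltW.
have lnA N : - ln (A N) <= D%:R * ln N.+1%:R - ln c.
  have := Ac N; rewrite -ler_ln ?posrE ?divr_gt0 ?exprn_gt0//.
  rewrite ln_div ?posrE ?exprn_gt0// lnXn// -mulr_natl; lra.
have lower N : s ^+ 2 * D.+1%:R * ln N.+1%:R - s ^+ 2 * (ln (A 0%N) - ln c) <=
    \sum_(k < N) ((k + n)%:R ^+ 2 * x k)^-1.
  apply: (@le_trans _ _ (\sum_(k < N) (2 * s / n%:R * y k - s ^+ 2 * x k))); last first.
    by apply: ler_sum => k _; exact: term.
  rewrite sumrB -!mulr_sumr sumx sumy.
  have -> : 2 * s / n%:R = 2 * s ^+ 2 * D.+1%:R.
    by rewrite /s; field; rewrite !gt_eqF// ltr0n.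
  have : s ^+ 2 * (ln (A 0%N) - ln (A N) + ln N.+1%:R) <=
      s ^+ 2 * (ln (A 0%N) - ln c + D.+1%:R * ln N.+1%:R).
    rewrite ler_pM2l ?exprn_gt0// -[D.+1%:R]natr1; have := lnA N; lra.
  lra.
have [N NM] : exists N, (M + s ^+ 2 * (ln (A 0%N) - ln c)) / (s ^+ 2 * D.+1%:R) < ln N.+1%:R.
  set a := (_ / _); exists (Num.truncn (expR a)).
  rewrite -ltr_expR lnK ?posrE//.
  exact: real_truncnS_gt.
exists N; apply: lt_le_trans (lower N).
by rewrite ltrBrDr -ltr_pdivrMl ?mulr_gt0 ?exprn_gt0// mulrC.
Qed.

(** The choice s = 1 / (8 n (k + 1)) meets the smallness conditions of [ball_moment_ge] for every k.
    The exponent 2 n comes from the volume of the box; any fixed exponent would serve the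
    divergence. *)
Lemma ball_moment_lower_bound {R : realType} {n : nat} (i : 'I_n) k :
  2^-1 * (8 * n%:R) ^- (2 * n) / k.+1%:R ^+ (2 * n) <= ball_moment (R := R) i k.
Proof.
have n0 : (0 < n)%N by case: n i => // -[].
have nR : 1 <= n%:R :> R by rewrite ler1n.
have kR : 1 <= k.+1%:R :> R by rewrite ler1n.
pose s : R := (8 * n%:R * k.+1%:R)^-1.
have p0 : 0 < 8 * n%:R * k.+1%:R :> R by rewrite !mulr_gt0 ?ltr0n.
rewrite -mulrA -invfM -exprMn -exprVn; apply: ball_moment_ge; first by rewrite invr_gt0.
- rewrite ltr_pdivrMr// mul1r; apply: (@lt_le_trans _ _ (8 * n%:R)).
    by rewrite ltr_pMl ?ltr1n ?ltr0n.
  by rewrite ler_peMr// mulr_ge0.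
- rewrite ler_pdivrMr// mul1r -mulrA ler_pM2l//.
  apply: (@le_trans _ _ k.+1%:R); first by rewrite ler_nat.
  by rewrite ler_peMl.
- rewrite ler_pdivrMr// mul1r -mulrA; have : 1 <= n%:R * k.+1%:R :> R by rewrite mulr_ege1.
  by lra.
Qed.

(** Bernoulli's inequality gives 1 - m / (2 m) = 1/2. This is the origin of the 4 in the cutoff
    parameter. *)
Lemma half_le_expr {R : realType} (m : nat) : (0 < m)%N ->
  2^-1 <= (1 - 2 / (4 * m%:R) : R) ^+ m.
Proof.
move=> m0; have mR : 0 < m%:R :> R by rewrite ltr0n.
have m1 : 1 <= m%:R :> R by rewrite ler1n.
have E : 2 / (4 * m%:R) = 2^-1 / m%:R :> R by field; rewrite gt_eqF.
rewrite E; apply: le_trans (bernoulli_le _ _ _).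
- by rewrite mulrCA divff ?gt_eqF// mulr1; lra.
- by rewrite divr_ge0 ?ltW// invr_ge0.
- by rewrite ler_pdivrMr// mul1r; lra.
Qed.

(** Finiteness matters here, since [fine] sends an infinite sum to 0. *)
Lemma sum_le_esum {R : realType} {I : choiceType} (a : I -> R) (F : seq I) :
  (forall i, 0 <= a i) -> uniq F -> (\esum_(i in [set: I]) (a i)%:E < +oo)%E ->
  \sum_(i <- F) a i <= fine (\esum_(i in [set: I]) (a i)%:E)%E.
Proof.
move=> a0 uF fin; rewrite -lee_fin fineK; last first.
  by rewrite ge0_fin_numE// esum_ge0// => i _; rewrite lee_fin.
rewrite -sumEFin; apply: esum_ge.
exists [set` F]; first by split => //; exact: finite_seq.
by rewrite fsbig_seq.
Qed.

Theorem mainTheorem4 (R : realType) (n : nat) (hn : (2 <= n)%N)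
    (S1 : ('I_n -> 'rV[R[i]]_n -> R[i]) -> 'rV[R[i]]_n -> R[i])
    (hS1 : canonical_solution_operator (@unit_ball R n) S1) :
  ~ hilbert_schmidt (bergman_forms (@unit_ball R n))
      (form_inner (@unit_ball R n)) (L2_inner (@unit_ball R n)) S1.
Proof.
move=> [I [e [[He orth dense] fin]]].
(* These are the indices 0 and 1; the second one exists because n >= 2. *)
pose i := Ordinal (ltnW hn); pose j := Ordinal hn.
have ij : j != i by [].
set B := @unit_ball R n.
have mB : measurable B := @measurable_unit_ball R n.
have n0 : (0 < n)%N := ltnW hn.
(* With this K the factor (1 - 2/K)^(k + n), lost by shrinking the ball, stays at least 1/2. *)
pose K k : R := 4 * (k + n)%:R.
have K2 k : 2 < K k.
  have : 1 <= (k + n)%:R :> R by rewrite ler1n addn_gt0 n0 orbT.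
  by rewrite /K; lra.
have K0 k : 0 < K k by have := K2 k; lra.
pose A := ball_moment (R := R) i.
have c0 : 0 < 2^-1 * (8 * n%:R) ^- (2 * n) :> R.
  by rewrite mulr_gt0 ?invr_gt0 ?exprn_gt0 ?mulr_gt0 ?ltr0n.
have [x [x0 Ax xdiv]] := moment_series_diverges c0 n0
  (@ball_moment_lower_bound R n i) (ball_momentS_le i).
have A0 k : 0 < A k.
  by apply: lt_le_trans (ball_moment_lower_bound i k); rewrite divr_gt0 ?exprn_gt0.
(* An upper bound for |psi_k|^2, with [x k] in place of 1 - A_(k+1)/A_k. Bessel's inequality asks
   for it to be positive, hence the need for [x k > 0]. *)
pose M k := 4 * K k ^+ 2 * (A k * x k).
have KK0 k : 0 < 4 * K k ^+ 2 by rewrite mulr_gt0 ?exprn_gt0.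
have M0 k : 0 < M k by apply: mulr_gt0 (KK0 k) (mulr_gt0 (A0 k) (x0 k)).
pose psi k := dbar_bump_conj i j k (K k).
pose h k := single_form j (fun z : 'rV[R[i]]_n => z ord0 i ^+ k).
pose v k := single_form j (fun z : 'rV[R[i]]_n => (radial_bump i k (K k) z)^*).
have L2form f : L2 B f -> forall l, L2 B (single_form j f l).
  move=> Lf l; rewrite /single_form; case: ifP => // _.
  exact: (semi_inner0 (L2_semi_inner mB)).
have Lh k l : L2 B (h k l).
  by apply: L2form; exact: (bergman_coordX i k).2.
have Lv k l : L2 B (v k l) by apply: L2form; exact: L2_bump_conj.
have Le m l : L2 B (e m l) by exact: (He m l).2.
have eqle (p q : R) : p = q -> p <= q by move=> ->.
pose T := fine (\esum_(m in [set: I]) (complex.Re (L2_inner B (S1 (e m)) (S1 (e m))))%:E)%E.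
(* A lower bound exp(-1) for the cutoff on the smaller ball, times a lower bound 1/2 for the share
   of A_k found there. *)
pose a : R := expR (-1) / 2.
have a0 : 0 < a by rewrite divr_gt0 ?expR_gt0.
have Iv k : exists2 J : R, form_inner B (h k) (v k) = J%:C & a * A k <= J.
  have [J JE Jge] := form_inner_coordX_bump i j k (K2 k); exists J => //.
  apply: le_trans Jge; rewrite /a -mulrA ler_pM2l ?expR_gt0//.
  apply: ler_wpM2r; first exact: ltW.
  by apply: half_le_expr; rewrite addn_gt0 n0 orbT.
(* The pairing of h_k with v_k is at least a A_k, and |h_k|^2 = A_k; dividing its square by 4 A_k
   gives this bound. *)
have parseval k : exists s : seq I, forall F, uniq F -> {subset s <= F} ->
    a ^+ 2 * A k / 4 <= \sum_(m <- F) sqnormc (form_inner B (e m) (v k)).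
  have [J JE Jge] := Iv k.
  have aA0 : 0 < a * A k by rewrite mulr_gt0.
  have hv : (a * A k) ^+ 2 <= sqnormc (form_inner B (h k) (v k)).
    rewrite JE sqnormc_real; apply: lerXn2r; rewrite ?nnegrE ?(ltW aA0)//.
    exact: le_trans (ltW aA0) Jge.
  have hv0 : 0 < sqnormc (form_inner B (h k) (v k)).
    by apply: lt_le_trans hv; rewrite exprn_gt0.
  have [s hs] := semi_inner_finite_parseval (form_semi_inner mB) Le orth
     (dense _ (single_form_bergman j (bergman_coordX i k))) (Lh k) (Lv k) hv0.
  exists s => F uF sF; have := le_trans hv (hs F uF sF).
  rewrite form_inner_coordX /= -/(A k) exprMn => le.
  rewrite ler_pdivrMr// -(@ler_pM2l _ (A k))//.
  apply: le_trans (_ : a ^+ 2 * A k ^+ 2 <= _); first by apply: eqle; ring.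
  by apply: le_trans le _; apply: eqle; ring.
have bessel N m : \sum_(k < N) sqnormc (form_inner B (e m) (v k)) / M k <=
    complex.Re (L2_inner B (S1 (e m)) (S1 (e m))).
  have [LS _ _] := hS1 _ (He m).
  rewrite (eq_bigr (fun k : 'I_N => sqnormc (L2_inner B (S1 (e m)) (psi k)) / M k)).
    apply: (semi_inner_bessel (L2_semi_inner mB)) => //.
    - by move=> k; exact: L2_dbar_bump_conj.
    - by move=> k l kl; exact: dbar_bump_conj_orthogonal.
    move=> k; apply: le_trans (L2_norm_dbar_bump_le ij k (K k)) _.
    by rewrite /M ler_pM2l ?KK0//; exact: Ax.
  by move=> k _; rewrite L2_inner_dbar_bump// sqnormcN.
(* The constant is 256 = 4 * 4 * 16: the 4 of the finite Parseval bound, the 4 in [M k], and K^2 =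
   16 (k + n)^2. *)
have [N] := xdiv (T * 256 / a ^+ 2).
apply/negP; rewrite -leNgt.
have [s hs] := choice parseval.
(* One finite set of basis indices serves all k < N, so the sums over k and over the basis can be
   exchanged. *)
pose F := undup (flatten [seq s k | k <- iota 0 N]).
have sF k : (k < N)%N -> {subset s k <= F}.
  move=> kN m ms; rewrite mem_undup; apply/flattenP; exists (s k) => //.
  by apply: map_f; rewrite mem_iota.
have a2 : 0 < a ^+ 2 / 256 by rewrite divr_gt0 ?exprn_gt0.
have -> : T * 256 / a ^+ 2 = T / (a ^+ 2 / 256) by field; rewrite gt_eqF.
rewrite ler_pdivlMr//.
have FT : \sum_(m <- F) complex.Re (L2_inner B (S1 (e m)) (S1 (e m))) <= T.
  apply: (sum_le_esum _ (undup_uniq _) fin) => m; exact: L2_inner_ge0.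
apply: le_trans FT.
apply: (@le_trans _ _ (\sum_(m <- F) \sum_(k < N)
    sqnormc (form_inner B (e m) (v k)) / M k)); last first.
  by apply: ler_sum => m _; exact: bessel.
rewrite exchange_big /= mulr_suml; apply: ler_sum => k _.
rewrite -mulr_suml ler_pdivlMr//; apply: le_trans (hs k F (undup_uniq _) (sF k (ltn_ord k))).
apply: eqle; rewrite /M /K.
have kn : (k + n)%:R != 0 :> R by rewrite pnatr_eq0 addn_eq0 negb_and orbC -lt0n n0.
by move: (x k) (x0 k) (_%:R) kn => X X0 m m0; field; rewrite m0 gt_eqF.
Qed.
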